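(* Let $(M^5,g,\xi,\eta,\varphi)$ be a generalized quasi-Sasaki manifold and let $\nabla^c$ be the metric connection $$g(\nabla^c_XY,Z)=g(\nabla^g_XY,Z)+\frac12\Big\{\big((d\eta-\gamma)\wedge\eta\big)(X,Y,Z)-N(X,Y,Z)\Big\},\qquad \gamma(X,Y):=d\Phi(\xi,\varphi(X),Y).$$ Then the torsion tensor of $\nabla^c$ is totally skew-symmetric if and only if $(M^5,g,\xi,\eta,\varphi)$ is of class $\mathcal W_3\oplus\mathcal W_4\oplus\mathcal W_5$, and it is traceless cyclic if and only if $(M^5,g,\xi,\eta,\varphi)$ is of class $\mathcal W_7$.
   Context: An almost contact metric structure on a Riemannian $5$-manifold $(M^5,g)$ is a triple $(\xi,\eta,\varphi)$: a unit vector field $\xi$, its dual $1$-form $\eta$, and an endomorphism $\varphi$ of $TM^5$ with $\varphi(\xi)=0$, $\varphi^2=-\mathrm{Id}+\eta\otimes\xi$, $g(\varphi(X),\varphi(Y))=g(X,Y)-\eta(X)\eta(Y)$. Its fundamental form is $\Phi(X,Y):=g(X,\varphi(Y))$; locally there are oriented orthonormal (''adapted'') frames $(e_1,\dots,e_5)$ with $\Phi=e_1\wedge e_2+e_3\wedge e_4$, $\eta=e_5$ ($TM^5$ is identified with its dual via $g$), and these fix the orientation. $\nabla^g$ is the Levi-Civita connection, $d\alpha=\sum_i e_i\wedge\nabla^g_{e_i}\alpha$, so $d\eta(X,Y)=(\nabla^g_X\eta)(Y)-(\nabla^g_Y\eta)(X)$, and $(\beta\wedge\eta)(X,Y,Z)=\beta(X,Y)\eta(Z)+\beta(Y,Z)\eta(X)+\beta(Z,X)\eta(Y)$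 for a $2$-form $\beta$. The Nijenhuis tensor is $$N(X,Y,Z):=g(X,[\varphi,\varphi](Y,Z))+\eta(X)\,d\eta(Y,Z),$$ $$[\varphi,\varphi](X,Y)=[\varphi(X),\varphi(Y)]+\varphi^2([X,Y])-\varphi([\varphi(X),Y])-\varphi([X,\varphi(Y)]).$$ A generalized quasi-Sasaki manifold is an almost contact metric $5$-manifold such that (i) $N(X,Y,Z)=0$ and $d\Phi(X,Y,Z)=0$ for all $X,Y,Z$ orthogonal to $\xi$; (ii) $\xi$ is a Killing vector field for $g$. On such a manifold $\gamma$ is a $2$-form. The torsion tensor of a metric connection $\nabla$ is $T(X,Y,Z)=g(\nabla_XY-\nabla_YX-[X,Y],Z)$. It is totally skew-symmetric if $T(X,Y,Z)+T(X,Z,Y)=0$, and traceless cyclic if $T(X,Y,Z)+T(Y,Z,X)+T(Z,X,Y)=0$ and $\sum_iT(X,e_i,e_i)=0$. Classes. Identify $\mathfrak{so}(5)$ with $\Lambda^2$. With $\ast$ the Hodge operator, $\Lambda^2=\Lambda^2_1\oplus\Lambda^2_2\oplus\Lambda^2_3\oplus\Lambda^2_4$, where $\Lambda^2_1=\{t\Phi\mid t\in\mathbb R\}$, $\Lambda^2_2=\{\beta\mid\Phi\wedge\beta=0,\ \ast\beta=\eta\wedge\beta\}$, $\Lambda^2_3=\{\beta\mid\ast\beta=-\eta\wedge\beta\}$, $\Lambda^2_4=\{\beta\mid\eta\wedge\beta=0\}$; then $\mathfrak u(2)=\Lambda^2_1\oplus\Lambda^2_3$ and $\mathfrak u(2)^\perp=\Lambda^2_2\oplus\Lambda^2_4$.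 With $\omega^g_{ij}=g(\nabla^ge_i,e_j)$ for an adapted frame and $\Omega^g=(\omega^g_{ij})$, the intrinsic torsion is $\Gamma(X):=\mathrm{pr}_{\mathfrak u(2)^\perp}(\Omega^g(X))$, a section of $\mathcal W:=\Lambda^1\otimes\mathfrak u(2)^\perp$. Let $\mathcal A:=\Lambda^1\otimes\Lambda^2$, $\mathrm{pr}_{\mathcal W}:\mathcal A\to\mathcal W$, $\alpha\otimes\beta\mapsto\alpha\otimes\mathrm{pr}_{\mathfrak u(2)^\perp}(\beta)$, and $\theta,\vartheta:\Lambda^2\to\mathcal A$, $\theta(\beta)(X,Y,Z):=\ast\beta(X,Y,Z)$, $\vartheta(\beta)(X,Y,Z):=3\,\eta(X)\beta(Y,Z)-\ast\beta(X,Y,Z)$. Then $\mathcal W_3=\mathrm{pr}_{\mathcal W}(\theta(\Lambda^2_1))$, $\mathcal W_4=\theta(\Lambda^2_2)$, $\mathcal W_5=\mathrm{pr}_{\mathcal W}(\theta(\Lambda^2_3))$, $\mathcal W_7=\vartheta(\Lambda^2_2)$. The manifold is of class $\mathcal W_{i_1}\oplus\dots\oplus\mathcal W_{i_j}$ if $\Gamma\in\mathcal W_{i_1}\oplus\dots\oplus\mathcal W_{i_j}$ at every point. *)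

(* Defs.v *)
From HB Require Import structures.
From mathcomp Require Import all_boot all_order all_algebra.
From mathcomp Require Import all_classical all_reals all_analysis.
Set Implicit Arguments.
Unset Strict Implicit.
Unset Printing Implicit Defensive.
Import Order.TTheory GRing.Theory Num.Theory.
Import numFieldNormedType.Exports.
Local Open Scope classical_set_scope.
Local Open Scope ring_scope.

Section Smooth.
Context {R : realType} {V W : normedModType R}.

Fixpoint iter_derive (f : V -> W) (s : seq V) : V -> W :=
  if s is v :: s' then fun x => 'D_v (iter_derive f s') x else f.

(* C^oo on E (meant for E open): all iterated directional derivatives are
   Frechet differentiable at every point of E. *)
Definition smooth_on (E : set V) (f : V -> W) :=
  forall (s : seq V) (x : V), E x -> differentiable (iter_derive f s) x.

End Smooth.

(* Smooth 5-manifolds without boundary, given by an atlas. The function [icoord i] is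
   the inverse of the chart [coord i] and is irrelevant outside the image
   [coord i @` dom i]; [chart_at p] is a chosen chart around p. *)
Record manifold5 (R : realType) (M : topologicalType) := Manifold5 {
  m_hausdorff : hausdorff_space M;
  m_second_countable : @second_countable M;
  chart : Type;
  dom : chart -> set M;
  coord : chart -> M -> 'rV[R]_5;
  icoord : chart -> 'rV[R]_5 -> M;
  chart_at : M -> chart;
  dom_open : forall i, open (dom i);
  img_open : forall i, open (coord i @` dom i);
  coordK : forall i p, dom i p -> icoord i (coord i p) = p;
  coord_continuous : forall i p, dom i p -> {for p, continuous (coord i)};
  icoord_continuous : forall i x, (coord i @` dom i) x ->
    {for x, continuous (icoord i)};
  mem_chart_at : forall p, dom (chart_at p) p;
  transition_smooth : forall i j,
    smooth_on (coord i @` (dom i `&` dom j)) (coord j \o icoord i) }.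

(* The tangent space at p is modelled on R^5: a tangent vector at p is
   represented by its components in the chart [chart_at A p]. A function
   M -> R^5 is therefore a (rough) vector field; since the chart varies with p,
   smoothness has to be tested in fixed charts, see [smooth_vf]. *)
Definition vfield (R : realType) (M : Type) := M -> 'rV[R]_5.

Section Calculus.
Context {R : realType} {M : topologicalType} (A : manifold5 R M).

Local Notation vfield := (vfield R M).

Implicit Types (f : M -> R) (X Y Z : vfield) (U : set M) (p : M).

(* components in chart i of the tangent vector v at p (p in [dom i]) *)
Definition tcoord (i : chart A) p (v : 'rV[R]_5) : 'rV[R]_5 :=
  'D_v (coord i \o icoord (chart_at A p)) (coord (chart_at A p) p).

Definition vf_in (i : chart A) X (x : 'rV[R]_5) : 'rV[R]_5 :=
  tcoord i (icoord i x) (X (icoord i x)).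

Definition smooth_fun U f :=
  forall i : chart A, smooth_on (coord i @` (dom i `&` U)) (f \o icoord i).

Definition smooth_vf U X :=
  forall i : chart A, smooth_on (coord i @` (dom i `&` U)) (vf_in i X).

(* X(f) *)
Definition dirder X f : M -> R := fun p =>
  'D_(X p) (f \o icoord (chart_at A p)) (coord (chart_at A p) p).

(* [X, Y] = DY(X) - DX(Y) in the chart [chart_at A p] *)
Definition lie X Y : vfield := fun p =>
  let i := chart_at A p in
  'D_(X p) (vf_in i Y) (coord i p) - 'D_(Y p) (vf_in i X) (coord i p).

Record riemannian (g : M -> 'rV[R]_5 -> 'rV[R]_5 -> R) : Prop := Riemannian {
  riem_linear : forall p a u v w, g p (a *: u + v) w = a * g p u w + g p v w;
  riem_sym : forall p u v, g p u v = g p v u;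
  riem_pos : forall p u, u != 0 -> 0 < g p u u;
  riem_smooth : forall U X Y, open U -> smooth_vf U X -> smooth_vf U Y ->
    smooth_fun U (fun p => g p (X p) (Y p)) }.

(* An operator D, with D X Y standing for nabla_X Y, is only constrained on
   fields that are smooth on an open set, and only at points of this set. *)
Record connection (D : vfield -> vfield -> vfield) : Prop := Connection {
  conn_smooth : forall U X Y, open U -> smooth_vf U X -> smooth_vf U Y ->
    smooth_vf U (D X Y);
  conn_linear : forall U f X X' Y p, open U -> smooth_fun U f ->
    smooth_vf U X -> smooth_vf U X' -> smooth_vf U Y -> U p ->
    D (fun q => f q *: X q + X' q) Y p = f p *: D X Y p + D X' Y p;
  conn_add : forall U X Y Y' p, open U ->
    smooth_vf U X -> smooth_vf U Y -> smooth_vf U Y' -> U p ->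
    D X (fun q => Y q + Y' q) p = D X Y p + D X Y' p;
  conn_leibniz : forall U f X Y p, open U -> smooth_fun U f ->
    smooth_vf U X -> smooth_vf U Y -> U p ->
    D X (fun q => f q *: Y q) p = dirder X f p *: Y p + f p *: D X Y p }.

Section Metric.
Variables (g : M -> 'rV[R]_5 -> 'rV[R]_5 -> R) (D : vfield -> vfield -> vfield).

Definition inner X Y : M -> R := fun p => g p (X p) (Y p).

Definition metric_connection := connection D /\
  forall U X Y Z p, open U ->
    smooth_vf U X -> smooth_vf U Y -> smooth_vf U Z -> U p ->
    dirder X (inner Y Z) p = inner (D X Y) Z p + inner Y (D X Z) p.

Definition torsion X Y Z : M -> R :=
  inner (fun p => D X Y p - D Y X p - lie X Y p) Z.

Definition levi_civita := metric_connection /\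
  forall U X Y p, open U -> smooth_vf U X -> smooth_vf U Y -> U p ->
    D X Y p - D Y X p = lie X Y p.

Definition orthonormal_frame U (e : 'I_5 -> vfield) :=
  (forall i, smooth_vf U (e i)) /\
  forall p i j, U p -> inner (e i) (e j) p = (i == j)%:R.

Definition totally_skew_torsion := forall U X Y Z p, open U ->
  smooth_vf U X -> smooth_vf U Y -> smooth_vf U Z -> U p ->
  torsion X Y Z p + torsion X Z Y p = 0.

Definition traceless_cyclic_torsion :=
  (forall U X Y Z p, open U ->
    smooth_vf U X -> smooth_vf U Y -> smooth_vf U Z -> U p ->
    torsion X Y Z p + torsion Y Z X p + torsion Z X Y p = 0) /\
  (forall U X (e : 'I_5 -> vfield) p, open U ->
    smooth_vf U X -> orthonormal_frame U e -> U p ->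
    \sum_i torsion X (e i) (e i) p = 0).

Definition killing Z := forall U X Y p, open U ->
  smooth_vf U X -> smooth_vf U Y -> U p ->
  dirder Z (inner X Y) p = inner (lie Z X) Y p + inner X (lie Z Y) p.

(* d alpha = \sum_i e_i /\ nabla_{e_i} alpha on 1-forms and 2-forms, evaluated
   on vector fields; forms are given as operators on vector fields. *)
Definition nabla1 (a : vfield -> M -> R) X Y : M -> R := fun p =>
  dirder X (a Y) p - a (D X Y) p.

Definition nabla2 (b : vfield -> vfield -> M -> R) X Y Z : M -> R := fun p =>
  dirder X (b Y Z) p - b (D X Y) Z p - b Y (D X Z) p.

Definition ext_d1 (a : vfield -> M -> R) X Y : M -> R := fun p =>
  nabla1 a X Y p - nabla1 a Y X p.

Definition ext_d2 (b : vfield -> vfield -> M -> R) X Y Z : M -> R := fun p =>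
  nabla2 b X Y Z p + nabla2 b Y Z X p + nabla2 b Z X Y p.

End Metric.

Record almost_contact_metric := AlmostContactMetric {
  acm_g : M -> 'rV[R]_5 -> 'rV[R]_5 -> R;
  acm_xi : vfield;
  acm_eta : M -> 'rV[R]_5 -> R;
  acm_phi : M -> 'rV[R]_5 -> 'rV[R]_5;
  acm_riemannian : riemannian acm_g;
  acm_xi_smooth : smooth_vf setT acm_xi;
  acm_phi_linear : forall p a u v,
    acm_phi p (a *: u + v) = a *: acm_phi p u + acm_phi p v;
  acm_phi_smooth : forall U X, open U -> smooth_vf U X ->
    smooth_vf U (fun p => acm_phi p (X p));
  acm_xi_unit : forall p, acm_g p (acm_xi p) (acm_xi p) = 1;
  acm_eta_dual : forall p v, acm_eta p v = acm_g p (acm_xi p) v;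
  acm_phi_xi : forall p, acm_phi p (acm_xi p) = 0;
  acm_phi_sq : forall p v,
    acm_phi p (acm_phi p v) = - v + acm_eta p v *: acm_xi p;
  acm_phi_metric : forall p u v,
    acm_g p (acm_phi p u) (acm_phi p v) =
    acm_g p u v - acm_eta p u * acm_eta p v }.

Section AlmostContact.
Variables (S : almost_contact_metric) (D : vfield -> vfield -> vfield).
(* in all uses D is the Levi-Civita connection of S *)

Local Notation xi := (acm_xi S).
Local Notation "<| X , Y |>" := (inner (acm_g S) X Y)
  (X at level 69, Y at level 69).

Definition etaf X : M -> R := fun p => acm_eta S p (X p).

Definition phif X : vfield := fun p => acm_phi S p (X p).

Definition fund X Y : M -> R := <| X, phif Y |>.

Definition deta X Y : M -> R := ext_d1 D etaf X Y.

Definition dfund X Y Z : M -> R := ext_d2 D fund X Y Z.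

Definition phi_bracket X Y : vfield := fun p =>
  lie (phif X) (phif Y) p + phif (phif (lie X Y)) p
  - phif (lie (phif X) Y) p - phif (lie X (phif Y)) p.

Definition nijenhuis X Y Z : M -> R := fun p =>
  <| X, phi_bracket Y Z |> p + etaf X p * deta Y Z p.

Definition generalized_quasi_sasaki :=
  (forall U X Y Z p, open U ->
    smooth_vf U X -> smooth_vf U Y -> smooth_vf U Z ->
    (forall q, U q ->
      [/\ <| X, xi |> q = 0, <| Y, xi |> q = 0 & <| Z, xi |> q = 0]) ->
    U p -> nijenhuis X Y Z p = 0 /\ dfund X Y Z p = 0) /\
  killing (acm_g S) xi.

Definition gammaf X Y : M -> R := dfund xi (phif X) Y.

Definition wedge_eta (b : vfield -> vfield -> M -> R) X Y Z : M -> R := fun p =>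
  b X Y p * etaf Z p + b Y Z p * etaf X p + b Z X p * etaf Y p.

Definition characteristic_formula (Dc : vfield -> vfield -> vfield) :=
  forall U X Y Z p, open U ->
    smooth_vf U X -> smooth_vf U Y -> smooth_vf U Z -> U p ->
    <| Dc X Y, Z |> p = <| D X Y, Z |> p +
      2^-1 * (wedge_eta (fun X' Y' q => deta X' Y' q - gammaf X' Y' q) X Y Z p
              - nijenhuis X Y Z p).

End AlmostContact.
End Calculus.

(* Algebra of the model space R^5 with basis e_1, ..., e_5: a 2-form b is the
   skew matrix b i j = b(e_i, e_j), which is also the identification of
   Lambda^2 with so(5). *)
Section Model.
Context {R : realType}.

Definition i1 : 'I_5 := @Ordinal 5 0 isT.
Definition i2 : 'I_5 := @Ordinal 5 1 isT.
Definition i3 : 'I_5 := @Ordinal 5 2 isT.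
Definition i4 : 'I_5 := @Ordinal 5 3 isT.
Definition i5 : 'I_5 := @Ordinal 5 4 isT.

Implicit Types b : 'M[R]_5.

Definition wedge_basis (i j : 'I_5) : 'M[R]_5 := delta_mx i j - delta_mx j i.

Definition Phi0 : 'M[R]_5 := wedge_basis i1 i2 + wedge_basis i3 i4.

Definition eta0 (k : 'I_5) : R := (k == i5)%:R.

(* the values at (e_i, e_j, e_k, e_l, e_m) of the volume form *)
Definition vol0 (i j k l m : 'I_5) : R :=
  \det (\matrix_(a, c) (nth i [:: i; j; k; l; m] a == c)%:R : 'M[R]_5).

(* Hodge star Lambda^2 -> Lambda^3 *)
Definition star b (k l m : 'I_5) : R :=
  2^-1 * \sum_i \sum_j b i j * vol0 i j k l m.

Definition eta_wedge b (k l m : 'I_5) : R :=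
  eta0 k * b l m + eta0 l * b m k + eta0 m * b k l.

Definition Phi_wedge b (i j k l : 'I_5) : R :=
  Phi0 i j * b k l - Phi0 i k * b j l + Phi0 i l * b j k
  + Phi0 j k * b i l - Phi0 j l * b i k + Phi0 k l * b i j.

Definition Lambda2 : set 'M[R]_5 := [set b | b^T = - b].

Definition Lambda2_1 : set 'M[R]_5 := [set b | exists t : R, b = t *: Phi0].

Definition Lambda2_2 : set 'M[R]_5 := Lambda2 `&`
  [set b | (forall i j k l, Phi_wedge b i j k l = 0) /\
           (forall k l m, star b k l m = eta_wedge b k l m)].

Definition Lambda2_3 : set 'M[R]_5 := Lambda2 `&`
  [set b | forall k l m, star b k l m = - eta_wedge b k l m].

Definition Lambda2_4 : set 'M[R]_5 := Lambda2 `&`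
  [set b | forall k l m, eta_wedge b k l m = 0].

Definition sum_set (E : zmodType) (B C : set E) : set E :=
  [set b + c | b in B & c in C].

Definition u2 := sum_set Lambda2_1 Lambda2_3.
Definition u2_perp := sum_set Lambda2_2 Lambda2_4.

(* projection of Lambda^2 = u(2) (+) u(2)^perp onto the second summand *)
Definition pr_perp b : 'M[R]_5 :=
  xget 0 [set c | u2_perp c /\ u2 (b - c)].

(* Lambda^1 (x) Lambda^2: the element a stands for
   (X, Y, Z) |-> a(X, Y, Z) with a k i j = a(e_k, e_i, e_j). *)
Definition L1L2 := {ffun 'I_5 -> 'M[R]_5}.

Definition pr_W (a : L1L2) : L1L2 := [ffun k => pr_perp (a k)].

Definition theta b : L1L2 := [ffun k => \matrix_(i, j) star b k i j].

Definition vartheta b : L1L2 :=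
  [ffun k => \matrix_(i, j) (3 * (eta0 k * b i j) - star b k i j)].

Definition W3 : set L1L2 := pr_W @` (theta @` Lambda2_1).
Definition W4 : set L1L2 := theta @` Lambda2_2.
Definition W5 : set L1L2 := pr_W @` (theta @` Lambda2_3).
Definition W7 : set L1L2 := vartheta @` Lambda2_2.

End Model.

Section Classes.
Context {R : realType} {M : topologicalType} {A : manifold5 R M}.
Variables (S : almost_contact_metric A).
Local Notation vfield := (vfield R M).
Variable D : vfield -> vfield -> vfield.

Definition adapted_frame (U : set M) (e : 'I_5 -> vfield) :=
  orthonormal_frame A (acm_g S) U e /\
  forall p, U p ->
    (forall i j, fund S (e i) (e j) p = Phi0 i j) /\
    (forall i, etaf S (e i) p = eta0 i).

(* components of the intrinsic torsion at p with respect to the adapted frame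
   e; D is the Levi-Civita connection *)
Definition intrinsic_torsion (e : 'I_5 -> vfield) (p : M) : L1L2 :=
  [ffun k => pr_perp (\matrix_(i, j) inner (acm_g S) (D (e k) (e i)) (e j) p)].

(* The spaces W_i are U(2)-invariant, so the condition does not depend on the
   local adapted frame used to identify the tangent space at p with R^5. *)
Definition of_class (W : set L1L2) := forall (U : set M) e (p : M),
  open U -> adapted_frame U e -> U p -> W (intrinsic_torsion e p).

End Classes.

(* Main.v *)
Require Import Defs.
From mathcomp Require Import all_boot all_order all_algebra.
From mathcomp Require Import all_classical all_reals all_analysis.
From mathcomp Require Import ring lra.

(** Put F(X; Y, Z) = g((nabla_X phi)Y, Z) and b(X, Y) = g(nabla_X xi, Y), where
    nabla is the Levi-Civita connection.  The tensors N, dPhi and deta, hence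
    the torsion T of nabla^c, are algebraic expressions in F, b, eta and phi,
    so everything can be compared at one point, in an adapted frame, which is
    constructed by projecting coordinate fields and adding images under phi.
    The vanishing of N and dPhi on the complement of xi forces F to vanish
    there and the Killing condition makes b skew, so the intrinsic torsion
    consists of b, a 2-form on the complement of xi, and of the
    Lambda^2_2-component d of the connection form in the direction xi.  Let P
    be the Lambda^2_2-component of b.  Up to antisymmetry in the first two
    arguments, the only nonzero parts of T are T(X, Y, xi) = 2b(X, Y) and
    T(xi, Y, Z) = (2b - P - d)(Y, Z).  So T is totally skew iff d = - P, and
    traceless cyclic iff b = P and d = 2P; the first condition describes
    W3 + W4 + W5 and the second one W7. *)

Set Implicit Arguments.
Unset Strict Implicit.
Unset Printing Implicit Defensive.
Import Order.TTheory GRing.Theory Num.Theory.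
Import numFieldNormedType.Exports.
Local Open Scope classical_set_scope.
Local Open Scope ring_scope.
Local Notation coord := Defs.coord.

(** * Smooth functions *)

(** Connections are constrained only on fields smooth on an open set, so the passage to one point
    needs proof: a cut-off that is 0 on the set and 1 outside shows that [D] is local, and expansion
    in a frame then shows that nabla phi and nabla xi at a point depend only on values there. The
    two sides of each equivalence quantify over different data, torsion over all local fields and
    the class over all adapted frames. Towards the class, a given adapted frame supplies the test
    fields; the converse has to construct one around the point. That F vanishes on the complement of
    xi is the argument known from Kaehler geometry; here it amounts to eight linear equations for
    the eight Lambda^2_2-coordinates of the connection form in the directions e_1, ..., e_4. For X,
    Y orthogonal to xi, skewness of T at (X, Y, xi) reads 2b - (2b - P - d) = 0, that is d = - P.
    The cyclic sum reads 2b + 2(2b - P - d) = 0, that is 3b = P + d; the right side lies in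
    Lambda^2_2, hence so does b, which gives b = P and d = 2P. *)

Lemma near_eq_differentiable (R : numFieldType) (V W : normedModType R)
    (f g : V -> W) (x : V) :
  {near x, f =1 g} -> differentiable f x -> differentiable g x.
Proof.
(* The expansion of [f] at [x] is also one of [g], and an expansion with continuous linear part
   determines the differential. *)
move=> fg df; have gdf : g \o shift x = cst (g x) + 'd f x +o_ 0 id.
  have /diff_locally/eqaddoP fo := df.
  apply/eqaddoP => e e0.
  have fg0 : \forall y \near 0, f (y + x) = g (y + x).
    by have := fg; rewrite (near_shift 0) subr0.
  have fgx : f x = g x by exact: (@nbhs_singleton _ _ (fun y => f y = g y)).
  by apply: filterS2 fg0 (fo e e0) => y fgy; rewrite !fctE /= fgy fgx.
have df_cont : continuous ('d f x) by exact: diff_continuous.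
by apply/diff_locallyP; rewrite (diff_unique df_cont gdf).
Qed.

Lemma derive_chain (R : realType) (U V W : normedModType R) (h : U -> V)
    (f : V -> W) x v :
  differentiable h x -> differentiable f (h x) ->
  'D_('D_v h x) f (h x) = 'D_v (f \o h) x.
Proof.
move=> dh df; rewrite (deriveE _ df) (deriveE _ dh) deriveE; last first.
  exact: differentiable_comp.
by rewrite (diff_comp dh df).
Qed.

Lemma open_near (T : topologicalType) (E : set T) x :
  open E -> E x -> \forall y \near x, E y.
Proof. by move=> oE Ex; apply: open_nbhs_nbhs. Qed.

Section IterDerive.
Context {R : realType} {V W : normedModType R}.
Implicit Types (f g : V -> W) (E : set V).

(** The head of the list is the outermost derivative; peeling off the innermost one instead allows
    induction with a varying function. *)
Lemma iter_derive_rcons f s v :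
  iter_derive f (rcons s v) = iter_derive ('D_v f) s.
Proof. by elim: s => //= u s ->. Qed.

Lemma iter_derive_eq E f g s : open E -> (forall x, E x -> f x = g x) ->
  forall x, E x -> iter_derive f s x = iter_derive g s x.
Proof.
move=> oE fg; elim: s => //= v s IH x Ex.
by apply: near_eq_derive; apply: filterS (open_near oE Ex).
Qed.

Lemma smooth_on_eq E f g : open E -> (forall x, E x -> f x = g x) ->
  smooth_on E f -> smooth_on E g.
Proof.
move=> oE fg sf s x Ex; apply: near_eq_differentiable (sf s x Ex).
by apply: filterS (open_near oE Ex) => y; apply: iter_derive_eq.
Qed.

Lemma smooth_on_sub E E' f : E' `<=` E -> smooth_on E f -> smooth_on E' f.
Proof. by move=> sE sf s x /sE; exact: sf. Qed.

Lemma smooth_on_derive E f v : smooth_on E f -> smooth_on E ('D_v f).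
Proof. by move=> sf s x Ex; rewrite -iter_derive_rcons; exact: sf. Qed.

Lemma smooth_on_diff E f x : smooth_on E f -> E x -> differentiable f x.
Proof. by move=> /(_ [::]); exact. Qed.

End IterDerive.

Section Scalar.
Context {R : realType} {V : normedModType R}.
Implicit Types (f g : V -> R) (E : set V).

(* [Cn E n f]: f is n+1 times differentiable on E *)
Fixpoint Cn E n f : Prop := (forall x, E x -> differentiable f x) /\
  if n is m.+1 then forall v, Cn E m ('D_v f) else True.

(** Counting orders suits the product and chain rules, whose right-hand sides are built from
    functions of lower order. *)
Lemma smooth_onP E f : smooth_on E f <-> forall n, Cn E n f.
Proof.
split.
  move=> sf n; elim: n f sf => [|n IH] f sf /=; split=> //.
  - by move=> x; exact: smooth_on_diff.
  - by move=> x; exact: smooth_on_diff.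
  - by move=> v; apply: IH; exact: smooth_on_derive.
move=> cf s; elim/last_ind: s f cf => [|s v IH] f cf.
  by have [+ _] := cf 0%N.
rewrite iter_derive_rcons; apply: IH => n.
have [_ f'] := cf n.+1; exact: f'.
Qed.

Lemma Cn_diff E n f x : Cn E n f -> E x -> differentiable f x.
Proof. by case: n => [|n] [+ _]; apply. Qed.

Lemma CnW E n f : Cn E n.+1 f -> Cn E n f.
Proof.
elim: n f => [|n IH] f [df cf]; first by split.
by split=> // v; apply/IH/cf.
Qed.

Lemma Cn_eq E n f g : open E -> (forall x, E x -> f x = g x) ->
  Cn E n f -> Cn E n g.
Proof.
move=> oE; elim: n f g => [|n IH] f g fg [df cf]; split=> //.
- move=> x Ex; apply: near_eq_differentiable (df x Ex).
  exact: filterS (open_near oE Ex).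
- move=> x Ex; apply: near_eq_differentiable (df x Ex).
  exact: filterS (open_near oE Ex).
- move=> v; apply: IH (cf v) => x Ex; apply: near_eq_derive.
  exact: filterS (open_near oE Ex).
Qed.

Lemma Cn_cst E n (a : R) : Cn E n (cst a).
Proof.
elim: n a => [|n IH] a; split=> // v.
have -> : 'D_v (cst a : V -> R) = cst 0 by apply/funext => x; rewrite derive_cst.
exact: IH.
Qed.

Lemma CnD E n f g : open E -> Cn E n f -> Cn E n g -> Cn E n (f \+ g).
Proof.
move=> oE; elim: n f g => [|n IH] f g [df cf] [dg cg]; split=> //.
- by move=> x Ex; apply: differentiableD; [exact: df|exact: dg].
- by move=> x Ex; apply: differentiableD; [exact: df|exact: dg].
move=> v; apply: Cn_eq (IH _ _ (cf v) (cg v)) => // x Ex /=.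
by rewrite deriveD //; apply: diff_derivable; [exact: df|exact: dg].
Qed.

Lemma CnM E n f g : open E -> Cn E n f -> Cn E n g -> Cn E n (f \* g).
Proof.
move=> oE; elim: n f g => [|n IH] f g cf cg.
  by split=> // x Ex; apply: differentiableM; apply: Cn_diff Ex; eassumption.
split=> [x Ex|v].
  by apply: differentiableM; apply: Cn_diff Ex; eassumption.
have [[df f'] [dg g']] := (cf, cg).
apply: Cn_eq (CnD oE (IH _ _ (CnW cf) (g' v)) (IH _ _ (CnW cg) (f' v))) => //.
move=> x Ex /=.
by rewrite deriveM //; apply: diff_derivable; [exact: df|exact: dg].
Qed.

Lemma Cn_sum E n k (F : 'I_k -> V -> R) : open E ->
  (forall i, Cn E n (F i)) -> Cn E n (fun x => \sum_i F i x).
Proof.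
move=> oE cF; elim: k F cF => [|k IH] F cF.
  apply: Cn_eq (Cn_cst E n 0) => // x _; by rewrite big_ord0.
apply: Cn_eq (CnD oE (cF ord0) (IH _ (fun i => cF (lift ord0 i)))) => // x _ /=.
by rewrite big_ord_recl.
Qed.

Let isqrt (a : R) := (Num.sqrt a)^-1.

Lemma diff_isqrt f x v : 0 < f x -> differentiable f x ->
  differentiable (isqrt \o f) x /\
  'D_v (isqrt \o f) x = - 2^-1 * (isqrt (f x) ^+ 3 * 'D_v f x).
Proof.
move=> f0 df.
have dS : differentiable (Num.sqrt : R -> R) (f x).
  by apply/derivable1_diffP; have [] := is_derive1_sqrt f0.
have dsf : differentiable (Num.sqrt \o f) x by exact: differentiable_comp.
have s0 : Num.sqrt (f x) != 0 by rewrite gt_eqF ?sqrtr_gt0.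
split.
  exact: (@differentiableV R _ (Num.sqrt \o f)).
have -> : isqrt \o f = (fun y => ((Num.sqrt \o f) y)^-1) by [].
rewrite deriveV //; last exact: diff_derivable.
rewrite -(derive_chain v df dS) (deriveE _ dS) (diff1E dS).
rewrite derive1E derive_sqrt // /isqrt /GRing.scale /=.
field; lra.
Qed.

(** The derivative of f^(-1/2) is -1/2 times the cube of f^(-1/2) times f', so the induction closes
    on this one function. *)
Lemma Cn_isqrt E n f : open E -> (forall x, E x -> 0 < f x) ->
  Cn E n f -> Cn E n (isqrt \o f).
Proof.
move=> oE f0; elim: n => [|n IH] cf.
  by split=> // x Ex; case: (diff_isqrt 0 (f0 x Ex) (Cn_diff cf Ex)).
split=> [x Ex|v]; first by case: (diff_isqrt 0 (f0 x Ex) (Cn_diff cf Ex)).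
have [df f'] := cf; have ch := IH (CnW cf).
apply: Cn_eq (CnM oE (Cn_cst E n (- 2^-1))
  (CnM oE (CnM oE ch (CnM oE ch ch)) (f' v))) => // x Ex.
have [_ /= ->] := diff_isqrt v (f0 x Ex) (df x Ex).
by rewrite !exprS expr0 mulr1.
Qed.

End Scalar.

(** * Chain rule and functions with values in row vectors *)

Section Composition.
Context {R : realType}.
Implicit Types (E : set 'rV[R]_5).

Lemma derive_comp (f : 'rV[R]_5 -> R) (h : 'rV[R]_5 -> 'rV[R]_5) x v :
  differentiable h x -> differentiable f (h x) ->
  'D_v (f \o h) x = \sum_i 'D_(delta_mx 0 i) f (h x) * 'D_v h x 0 i.
Proof.
move=> dh df; rewrite deriveE; last exact: differentiable_comp.
rewrite diff_comp //= -(deriveE v dh) {1}(row_sum_delta ('D_v h x)) linear_sum /=.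
by apply: eq_bigr => i _; rewrite linearZ /= [in RHS]deriveE // [RHS]mulrC.
Qed.

(** By the chain rule D_v (f o h) is the sum of the products of (d_i f) o h and D_v h_i, and the
    induction hypothesis applies to the partial derivatives of [f]. *)
Lemma Cn_comp E E' n (f : 'rV[R]_5 -> R) (h : 'rV[R]_5 -> 'rV[R]_5) :
  open E -> (forall x, E x -> E' (h x)) ->
  (forall x, E x -> differentiable h x) ->
  (forall i, Cn E n (fun x => h x 0 i)) -> Cn E' n f -> Cn E n (f \o h).
Proof.
move=> oE hE dh; elim: n f => [|n IH] f ch cf.
  split=> // x Ex; apply: differentiable_comp; first exact: dh.
  by apply: Cn_diff cf _; exact: hE.
split=> [x Ex|v].
  by apply: differentiable_comp; [exact: dh|apply: Cn_diff cf _; exact: hE].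
have [df f'] := cf.
have ch' i : Cn E n (fun x => h x 0 i) by exact/CnW/ch.
have cd i : Cn E n ('D_v (fun x => h x 0 i)) by have [_] := ch i; exact.
apply: (@Cn_eq _ _ _ _
  (fun x => \sum_i (('D_(delta_mx 0 i) f \o h) \* 'D_v (fun x => h x 0 i)) x)) => //.
  move=> x Ex; rewrite derive_comp; last exact/df/hE; last exact: dh.
  apply: eq_bigr => i _ /=; rewrite derive_mx ?mxE //.
  exact/diff_derivable/dh.
apply: Cn_sum => // i; exact: (CnM oE (IH _ ch' (f' _)) (cd i)).
Qed.

Lemma smooth_rowP E (F : 'rV[R]_5 -> 'rV[R]_5) : open E ->
  smooth_on E F <-> forall j, smooth_on E (fun x => F x 0 j).
Proof.
move=> oE.
have coordE s (G : 'rV[R]_5 -> 'rV[R]_5) j :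
    (forall x, E x -> forall s, differentiable (iter_derive G s) x) ->
    forall x, E x -> iter_derive (fun x => G x 0 j) s x = iter_derive G s x 0 j.
  move=> dG; elim: s => //= v s IH x Ex.
  rewrite derive_mx ?mxE; last exact/diff_derivable/dG.
  by apply: near_eq_derive; exact: filterS (open_near oE Ex).
have dcoord (G : 'rV[R]_5 -> 'rV[R]_5) x j : differentiable G x ->
    differentiable (fun x => G x 0 j) x.
  move=> dG.
  apply: (@differentiable_comp _ _ _ _ G (fun N : 'rV[R]_5 => N 0 j : R)) => //.
  exact: differentiable_coord.
split.
  move=> sF j s x Ex.
  apply: near_eq_differentiable (dcoord _ _ j (sF s x Ex)).
  apply: filterS (open_near oE Ex) => y Ey.
  by rewrite coordE // => z Ez s'; exact: sF.
move=> sF s.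
(* Both claims are proved together: components can be taken inside a derivative only where the
   vector-valued function is differentiable. *)
suff H : forall x, E x -> differentiable (iter_derive F s) x /\
    forall j, iter_derive (fun x => F x 0 j) s x = iter_derive F s x 0 j.
  by move=> x /H[].
elim: s => [|v s IH] x Ex /=.
  split=> //.
  have -> : F = fun x => \sum_j F x 0 j *: delta_mx 0 j.
    by apply/funext => y; exact: row_sum_delta.
  have -> : (fun x => \sum_j F x 0 j *: delta_mx 0 j) =
      \sum_j (fun x => F x 0 j *: (delta_mx 0 j : 'rV[R]_5)).
    by apply/funext => y; rewrite fct_sumE.
  apply: differentiable_sum => j; apply: differentiableZl; exact: (sF j [::]).
have Dj y : E y -> forall j, 'D_v (iter_derive (fun x => F x 0 j) s) y =
    'D_v (iter_derive F s) y 0 j.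
  move=> Ey j; rewrite derive_mx ?mxE; last by apply: diff_derivable; case: (IH y Ey).
  apply: near_eq_derive; apply: filterS (open_near oE Ey) => z /IH[_]; exact.
split; last exact: Dj.
set G := 'D_v _.
have -> : G = fun x => \sum_j G x 0 j *: delta_mx 0 j.
  by apply/funext => y; exact: row_sum_delta.
have -> : (fun x => \sum_j G x 0 j *: delta_mx 0 j) =
    \sum_j (fun x => G x 0 j *: (delta_mx 0 j : 'rV[R]_5)).
  by apply/funext => y; rewrite fct_sumE.
apply: differentiable_sum => j; apply: differentiableZl.
apply: near_eq_differentiable (sF j (v :: s) x Ex).
by apply: filterS (open_near oE Ex) => y Ey /=; rewrite Dj.
Qed.

End Composition.

(** * Vector fields and connections *)

Section SmoothOn.
Context {R : realType}.
Implicit Types (E : set 'rV[R]_5) (f g : 'rV[R]_5 -> R).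

Lemma smooth_on_cst E a : smooth_on E (fun _ => a : R).
Proof. by apply/smooth_onP => n; exact: Cn_cst. Qed.

Lemma smooth_onD E f g : open E -> smooth_on E f -> smooth_on E g ->
  smooth_on E (fun x => f x + g x).
Proof.
move=> oE /smooth_onP sf /smooth_onP sg; apply/smooth_onP => n; exact: CnD.
Qed.

Lemma smooth_onM E f g : open E -> smooth_on E f -> smooth_on E g ->
  smooth_on E (fun x => f x * g x).
Proof.
move=> oE /smooth_onP sf /smooth_onP sg; apply/smooth_onP => n; exact: CnM.
Qed.

Lemma smooth_on_isqrt E f : open E -> (forall x, E x -> 0 < f x) ->
  smooth_on E f -> smooth_on E (fun x => (Num.sqrt (f x))^-1).
Proof.
move=> oE f0 /smooth_onP sf; apply/smooth_onP => n; exact: Cn_isqrt.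
Qed.

Lemma smooth_on_comp E E' (F h : 'rV[R]_5 -> 'rV[R]_5) :
  open E -> open E' -> (forall x, E x -> E' (h x)) -> smooth_on E h ->
  smooth_on E' F -> smooth_on E (F \o h).
Proof.
move=> oE oE' hE sh /(smooth_rowP _ oE') sF; apply/(smooth_rowP _ oE) => j.
have dh x : E x -> differentiable h x by exact: smooth_on_diff.
move/(smooth_rowP _ oE): sh => sh.
apply/smooth_onP => n.
apply: (@Cn_comp _ E E' n (fun x => F x 0 j) h) => //.
  by move=> i; have /smooth_onP := sh i; exact.
by have /smooth_onP := sF j; exact.
Qed.

End SmoothOn.

Section Fields.
Context {R : realType} {M : topologicalType} (A : manifold5 R M).
Local Notation vfield := (vfield R M).
Implicit Types (f : M -> R) (X Y Z : vfield) (U V : set M) (p : M).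

Lemma open_img (i : chart A) U : open U -> open (coord i @` (dom i `&` U)).
Proof.
move=> oU; rewrite openE => x [p [dp Up] <-{x}].
have ix : (coord i @` dom i) (coord i p) by exists p.
have c := icoord_continuous ix.
have nU : \forall y \near coord i p, U (icoord i y).
  by apply: c; rewrite (coordK dp); exact: open_nbhs_nbhs.
have nI := open_near (@img_open _ _ _ i) ix.
apply: filterS2 nU nI => y Uy [q dq qy]; exists q => //; split=> //.
by rewrite -qy coordK in Uy.
Qed.

Lemma icoord_img (i : chart A) U x : (coord i @` (dom i `&` U)) x ->
  [/\ dom i (icoord i x), U (icoord i x) & coord i (icoord i x) = x].
Proof. by move=> [p [dp Up] <-]; rewrite coordK. Qed.

Lemma smooth_fun_cst U (a : R) : smooth_fun A U (fun _ => a).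
Proof. by move=> i; exact: smooth_on_cst. Qed.

Lemma smooth_funM U f g : open U -> smooth_fun A U f -> smooth_fun A U g ->
  smooth_fun A U (fun p => f p * g p).
Proof. by move=> oU sf sg i; apply: smooth_onM => //; exact: open_img. Qed.

Lemma smooth_funN U f : open U -> smooth_fun A U f ->
  smooth_fun A U (fun p => - f p).
Proof.
move=> oU sf; have -> : (fun p => - f p) = (fun p => -1 * f p).
  by apply/funext => p; rewrite mulN1r.
by apply: smooth_funM => //; exact: smooth_fun_cst.
Qed.

Lemma smooth_fun_isqrt U f : open U -> (forall p, U p -> 0 < f p) ->
  smooth_fun A U f -> smooth_fun A U (fun p => (Num.sqrt (f p))^-1).
Proof.
move=> oU f0 sf i; apply: smooth_on_isqrt => //; first exact: open_img.
by move=> x /icoord_img[_ Ux _]; exact: f0.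
Qed.

Lemma img_sub (i : chart A) U V : V `<=` U ->
  coord i @` (dom i `&` V) `<=` coord i @` (dom i `&` U).
Proof. by move=> VU x [p [dp /VU Up] <-]; exists p. Qed.

Lemma smooth_vf_sub U V X : V `<=` U -> smooth_vf A U X -> smooth_vf A V X.
Proof. by move=> VU sf i; apply: smooth_on_sub (sf i); exact: img_sub. Qed.

Lemma smooth_fun_eq U f g : open U -> (forall p, U p -> f p = g p) ->
  smooth_fun A U f -> smooth_fun A U g.
Proof.
move=> oU fg sf i; apply: smooth_on_eq (sf i); first exact: open_img.
by move=> x /icoord_img[_ Ux _]; exact: fg.
Qed.

Lemma smooth_vf_eq U X Y : open U -> (forall p, U p -> X p = Y p) ->
  smooth_vf A U X -> smooth_vf A U Y.
Proof.
move=> oU fg sf i; apply: smooth_on_eq (sf i); first exact: open_img.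
by move=> x /icoord_img[_ Ux _]; rewrite /vf_in fg.
Qed.

Lemma transition_diff (i j : chart A) p : dom i p -> dom j p ->
  differentiable (coord j \o icoord i) (coord i p).
Proof.
by move=> di dj; apply: smooth_on_diff (@transition_smooth _ _ _ i j) _; exists p.
Qed.

Lemma tcoordP (i : chart A) p a u v : dom i p ->
  tcoord i p (a *: u + v) = a *: tcoord i p u + tcoord i p v.
Proof.
move=> di; have d := transition_diff (mem_chart_at A p) di.
by rewrite /tcoord !deriveE // linearP.
Qed.

Lemma smooth_vf_comb U f X Y : open U -> smooth_fun A U f ->
  smooth_vf A U X -> smooth_vf A U Y ->
  smooth_vf A U (fun p => f p *: X p + Y p).
Proof.
move=> oU sf sX sY i; have oE := @open_img i _ oU.
apply: (@smooth_on_eq _ _ _ _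
  (fun x => f (icoord i x) *: vf_in i X x + vf_in i Y x)) => //.
  by move=> x /icoord_img[dx Ux _]; rewrite /vf_in tcoordP.
apply/(smooth_rowP _ oE) => j.
have -> : (fun x => (f (icoord i x) *: vf_in i X x + vf_in i Y x) 0 j) =
    (fun x => (f \o icoord i) x * vf_in i X x 0 j + vf_in i Y x 0 j).
  by apply/funext => x; rewrite !mxE.
apply: smooth_onD => //; last by have /(smooth_rowP _ oE) := sY i.
by apply: smooth_onM; [|exact: sf|have /(smooth_rowP _ oE) := sX i].
Qed.

Lemma smooth_vf0 U : open U -> smooth_vf A U (fun _ => 0).
Proof.
move=> oU i; have oE := @open_img i _ oU.
apply: (@smooth_on_eq _ _ _ _ (fun x => 0)) => //.
  move=> x /icoord_img[dx Ux _]; rewrite /vf_in.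
  have := @tcoordP i (icoord i x) (-1) 0 0 dx.
  by rewrite scaler0 addr0 scaleN1r addNr => ->.
apply/(smooth_rowP _ oE) => j.
have -> : (fun x : 'rV[R]_5 => (0 : 'rV[R]_5) 0 j) = fun=> 0.
  by apply/funext => x; rewrite mxE.
exact: smooth_on_cst.
Qed.

Lemma smooth_vfZ U f X : open U -> smooth_fun A U f -> smooth_vf A U X ->
  smooth_vf A U (fun p => f p *: X p).
Proof.
move=> oU sf sX; have := smooth_vf_comb oU sf sX (smooth_vf0 oU).
by congr smooth_vf; apply/funext => p; rewrite addr0.
Qed.

Lemma smooth_vfD U X Y : open U -> smooth_vf A U X -> smooth_vf A U Y ->
  smooth_vf A U (fun p => X p + Y p).
Proof.
move=> oU sX sY; have := smooth_vf_comb oU (@smooth_fun_cst U 1) sX sY.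
by congr smooth_vf; apply/funext => p; rewrite scale1r.
Qed.

Lemma smooth_vfN U X : open U -> smooth_vf A U X ->
  smooth_vf A U (fun p => - X p).
Proof.
move=> oU sX; have := smooth_vfZ oU (@smooth_fun_cst U (-1)) sX.
by congr smooth_vf; apply/funext => p; rewrite scaleN1r.
Qed.

Lemma smooth_vf_sum n U (F : 'I_n -> vfield) : open U ->
  (forall i, smooth_vf A U (F i)) -> smooth_vf A U (fun p => \sum_i F i p).
Proof.
move=> oU; elim: n F => [|n IH] F sF.
  have := smooth_vf0 oU; congr smooth_vf.
  by apply/funext => p; rewrite big_ord0.
have := smooth_vfD oU (sF ord0) (IH _ (fun i => sF (lift ord0 i))).
by congr smooth_vf; apply/funext => p; rewrite big_ord_recl.
Qed.

(** The constant field [v] of chart [i], written at each point in the components of the chart chosen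
    there, as every [vfield] is. *)
Definition chart_field (i : chart A) (v : 'rV[R]_5) : vfield := fun p =>
  'D_v (coord (chart_at A p) \o icoord i) (coord i p).

(** The chosen chart varies with the point without any regularity, but the chain rule eliminates it:
    in chart [j] the field is a directional derivative of the transition from [i] to [j]. *)
Lemma smooth_chart_field i v : smooth_vf A (dom i) (chart_field i v).
Proof.
move=> j; have oE := @open_img j _ (dom_open i).
have oE' := @open_img i _ (dom_open j).
apply: (@smooth_on_eq _ _ _ _
  ('D_v (coord j \o icoord i) \o (coord i \o icoord j)) _ oE).
  move=> x xE; have [djx dix _] := icoord_img xE.
  rewrite /vf_in /tcoord /chart_field /=.
  set p := icoord j x in djx dix *; set c := chart_at A p.
  have dcp := mem_chart_at A p : dom c p.
  have E1 := transition_diff dix dcp.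
  have E2 := transition_diff dcp djx.
  have cE : coord c p = (coord c \o icoord i) (coord i p) by rewrite /= coordK.
  rewrite cE in E2 *; rewrite (derive_chain _ E1 E2).
  apply: near_eq_derive.
  have oN : open (coord i @` (dom i `&` dom c)) by exact/open_img/dom_open.
  apply: filterS (open_near oN _); last by exists p.
  by move=> y /icoord_img[_ dcy _] /=; rewrite coordK.
apply: (smooth_on_comp oE oE').
- by move=> x /icoord_img[djx dix _]; exists (icoord j x).
- by have := @transition_smooth _ _ _ j i.
- exact/smooth_on_derive/transition_smooth.
Qed.

Lemma chart_field_at p v : chart_field (chart_at A p) v p = v.
Proof.
rewrite /chart_field -[RHS](@derive_id _ _ (coord (chart_at A p) p) v).
apply: near_eq_derive.
apply: filterS (open_near (@img_open _ _ _ (chart_at A p)) _).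
  by move=> y [q dq <-] /=; rewrite coordK.
by exists p => //; exact: mem_chart_at.
Qed.

Lemma dirder_cst U X f a p : open U -> U p -> (forall q, U q -> f q = a) ->
  dirder A X f p = 0.
Proof.
move=> oU Up fa; rewrite /dirder.
rewrite -[RHS](@derive_cst R 'rV[R]_5 R a (coord (chart_at A p) p) (X p)).
apply: near_eq_derive.
apply: filterS (open_near (@open_img (chart_at A p) _ oU) _).
  by move=> y /icoord_img[_ Uy _] /=; exact: fa.
by exists p => //; split=> //; exact: mem_chart_at.
Qed.

(** Used to normalize a field near a point where it does not vanish. Continuity is available in the
    chart, so positivity is carried there and back. *)
Lemma smooth_fun_pos U f p : open U -> smooth_fun A U f -> U p -> 0 < f p ->
  exists V, [/\ open V, V `<=` U, V p & forall q, V q -> 0 < f q].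
Proof.
move=> oU sf Up fp; set i := chart_at A p; have dp := mem_chart_at A p.
have oE := @open_img i _ oU.
have cf : {for coord i p, continuous (f \o icoord i)}.
  apply/differentiable_continuous/(smooth_on_diff (sf i)).
  by exists p.
have n1 : \forall x \near coord i p, 0 < f (icoord i x).
  have := @cvgr_gt _ _ (nbhs (coord i p)) _ (f \o icoord i) _ cf 0.
  by rewrite /= coordK //; apply.
have n2 : \forall q \near p, 0 < f (icoord i (coord i q)).
  exact: (Defs.coord_continuous dp n1).
have n3 : \forall q \near p, (U `&` [set q | 0 < f q]) q.
  have nd := open_near (dom_open i) dp; have nU := open_near oU Up.
  by apply: filterS3 n2 nd nU => q /= + dq Uq; rewrite coordK.
exists ((U `&` [set q | 0 < f q])°); split.
- exact: open_interior.
- by move=> q /interior_subset[].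
- exact: n3.
- by move=> q /interior_subset[].
Qed.

Local Opaque smooth_vf smooth_fun.

(** * Locality of connections and their expansion in a frame *)

Section Connection.
Variable D : vfield -> vfield -> vfield.
Hypothesis hD : connection A D.

(* f = 0 on U and f = 1 elsewhere is smooth on U and kills X - X'. *)
Lemma conn_local_l U X X' Y p : open U -> smooth_vf A U X -> smooth_vf A U Y ->
  U p -> (forall q, U q -> X q = X' q) -> D X Y p = D X' Y p.
Proof.
move=> oU sX sY Up XX'.
pose f q : R := if `[< U q >] then 0 else 1.
have fU q : U q -> f q = 0 by rewrite /f => /asboolT ->.
have sf : smooth_fun A U f.
  by apply: (smooth_fun_eq oU _ (@smooth_fun_cst U 0)) => q /fU ->.
have sX' : smooth_vf A U X' by apply: smooth_vf_eq sX.
have sN := smooth_vfD oU sX' (smooth_vfN oU sX).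
have -> : X' = fun q => f q *: (X' q - X q) + X q.
  apply/funext => q; rewrite /f; case: asboolP => [/XX' ->|_].
    by rewrite scale0r add0r.
  by rewrite scale1r subrK.
by rewrite (conn_linear hD oU sf sN sX sY Up) fU // scale0r add0r.
Qed.

Lemma conn0r U X p : open U -> smooth_vf A U X -> U p -> D X (fun _ => 0) p = 0.
Proof.
move=> oU sX Up; have s0 := smooth_vf0 oU.
have := conn_add hD oU sX s0 s0 Up.
rewrite (_ : (fun _ => 0 + 0) = fun _ => 0) //; last first.
  by apply/funext => q; rewrite addr0.
by move/(congr1 (fun v => v - D X (fun _ => 0) p)); rewrite subrr addrK.
Qed.

(** The same cut-off works in the second argument, since its derivative in the Leibniz rule
    multiplies Y' p - Y p, which is zero. *)
Lemma conn_local_r U X Y Y' p : open U -> smooth_vf A U X -> smooth_vf A U Y ->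
  U p -> (forall q, U q -> Y q = Y' q) -> D X Y p = D X Y' p.
Proof.
move=> oU sX sY Up YY'.
pose f q : R := if `[< U q >] then 0 else 1.
have fU q : U q -> f q = 0 by rewrite /f => /asboolT ->.
have sf : smooth_fun A U f.
  by apply: (smooth_fun_eq oU _ (@smooth_fun_cst U 0)) => q /fU ->.
have sY' : smooth_vf A U Y' by apply: smooth_vf_eq sY.
have sN := smooth_vfD oU sY' (smooth_vfN oU sY).
have -> : Y' = fun q => f q *: (Y' q - Y q) + Y q.
  apply/funext => q; rewrite /f; case: asboolP => [/YY' ->|_].
    by rewrite scale0r add0r.
  by rewrite scale1r subrK.
rewrite (conn_add hD oU sX (smooth_vfZ oU sf sN) sY Up).
rewrite (conn_leibniz hD oU sf sX sN Up) fU // scale0r (YY' p Up) subrr scaler0.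
by rewrite !add0r.
Qed.

Lemma conn_suml n U (f : 'I_n -> M -> R) (F : 'I_n -> vfield) Y p : open U ->
  (forall i, smooth_fun A U (f i)) -> (forall i, smooth_vf A U (F i)) ->
  smooth_vf A U Y -> U p ->
  D (fun q => \sum_i f i q *: F i q) Y p = \sum_i f i p *: D (F i) Y p.
Proof.
move=> oU + + sY Up; elim: n f F => [|n IH] f F sf sF.
  rewrite big_ord0 (_ : (fun _ => _) = fun _ => 0); last first.
    by apply/funext => q; rewrite big_ord0.
  have s0 := smooth_vf0 oU.
  have := conn_linear hD oU (@smooth_fun_cst U 1) s0 s0 sY Up.
  rewrite (_ : (fun _ => 1 *: 0 + 0) = fun _ => 0); last first.
    by apply/funext => q; rewrite scale1r addr0.
  rewrite scale1r; move/(congr1 (fun v => v - D (fun _ => 0) Y p)).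
  by rewrite subrr addrK.
rewrite big_ord_recl -(IH _ _ (fun i => sf (lift ord0 i)) (fun i => sF (lift ord0 i))).
have sS : smooth_vf A U (fun q => \sum_i f (lift ord0 i) q *: F (lift ord0 i) q).
  exact: (smooth_vf_sum oU (fun i => smooth_vfZ oU (sf _) (sF _))).
rewrite -(conn_linear hD oU (sf ord0) (sF ord0) sS sY Up).
by congr D; apply/funext => q; rewrite big_ord_recl.
Qed.

Lemma conn_sumr n U X (f : 'I_n -> M -> R) (F : 'I_n -> vfield) p : open U ->
  smooth_vf A U X ->
  (forall i, smooth_fun A U (f i)) -> (forall i, smooth_vf A U (F i)) -> U p ->
  D X (fun q => \sum_i f i q *: F i q) p =
  \sum_i (dirder A X (f i) p *: F i p + f i p *: D X (F i) p).
Proof.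
move=> oU sX + + Up; elim: n f F => [|n IH] f F sf sF.
  rewrite big_ord0 (_ : (fun _ => _) = fun _ => 0); last first.
    by apply/funext => q; rewrite big_ord0.
  exact: conn0r Up.
rewrite big_ord_recl -(IH _ _ (fun i => sf (lift ord0 i)) (fun i => sF (lift ord0 i))).
have sS : smooth_vf A U (fun q => \sum_i f (lift ord0 i) q *: F (lift ord0 i) q).
  exact: (smooth_vf_sum oU (fun i => smooth_vfZ oU (sf _) (sF _))).
rewrite -(conn_leibniz hD oU (sf _) sX (sF _) Up).
rewrite -(conn_add hD oU sX (smooth_vfZ oU (sf _) (sF _)) sS Up).
by congr D; apply/funext => q; rewrite big_ord_recl.
Qed.

End Connection.
End Fields.

(** * Adapted frames *)

Lemma I5_ind (P : 'I_5 -> Prop) :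
  P i1 -> P i2 -> P i3 -> P i4 -> P i5 -> forall i, P i.
Proof.
move=> ? ? ? ? ? [[|[|[|[|[|m]]]]] // lt_m]; set i := Ordinal _.
- by have -> : i = i1 by exact/val_inj.
- by have -> : i = i2 by exact/val_inj.
- by have -> : i = i3 by exact/val_inj.
- by have -> : i = i4 by exact/val_inj.
- by have -> : i = i5 by exact/val_inj.
Qed.

Lemma big_I5 (T : nmodType) (F : 'I_5 -> T) :
  \sum_i F i = F i1 + F i2 + F i3 + F i4 + F i5.
Proof.
rewrite !big_ord_recr big_ord0 /= add0r.
by congr (_ + _ + _ + _ + _); congr F; exact/val_inj.
Qed.

Lemma exists_kermx_vector (F : fieldType) m n (B : 'M[F]_(m, n)) : (n < m)%N ->
  exists2 v : 'rV[F]_m, v != 0 & v *m B = 0.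
Proof.
move=> nm; have /rowV0Pn[v vB v0] : kermx B != 0.
  by rewrite kermx_eq0 /row_free ltn_eqF // (leq_ltn_trans (rank_leq_col B)).
by exists v => //; exact/sub_kermxP.
Qed.

Local Opaque smooth_vf smooth_fun.

Section Metric.
Context {R : realType} {M : topologicalType} {A : manifold5 R M}.
Local Notation vfield := (vfield R M).
Variable g : M -> 'rV[R]_5 -> 'rV[R]_5 -> R.
Hypothesis hg : riemannian A g.
Implicit Types (X Y Z : vfield) (U V : set M) (p : M) (u v w : 'rV[R]_5).

Lemma riemC p u v : g p u v = g p v u. Proof. exact: riem_sym hg _ _ _. Qed.

Lemma riem0l p v : g p 0 v = 0.
Proof.
have := riem_linear hg p (-1) 0 0 v.
by rewrite scaler0 addr0 mulN1r addNr.
Qed.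

Lemma riemDl p u v w : g p (u + v) w = g p u w + g p v w.
Proof. by have := riem_linear hg p 1 u v w; rewrite scale1r mul1r. Qed.

Lemma riemZl p a u w : g p (a *: u) w = a * g p u w.
Proof. by have := riem_linear hg p a u 0 w; rewrite riem0l !addr0. Qed.

Lemma riemNl p u w : g p (- u) w = - g p u w.
Proof. by rewrite -scaleN1r riemZl mulN1r. Qed.

Lemma riem0r p v : g p v 0 = 0. Proof. by rewrite riemC riem0l. Qed.

Lemma riemDr p u v w : g p u (v + w) = g p u v + g p u w.
Proof. by rewrite riemC riemDl !(riemC _ _ u). Qed.

Lemma riemZr p a u w : g p u (a *: w) = a * g p u w.
Proof. by rewrite riemC riemZl riemC. Qed.

Lemma riemNr p u w : g p u (- w) = - g p u w.
Proof. by rewrite riemC riemNl riemC. Qed.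

Lemma riem_sumr n p u (F : 'I_n -> 'rV[R]_5) :
  g p u (\sum_i F i) = \sum_i g p u (F i).
Proof.
elim: n F => [|n IH] F; first by rewrite !big_ord0 riem0r.
by rewrite !big_ord_recl riemDr IH.
Qed.

Lemma riem_suml n p u (F : 'I_n -> 'rV[R]_5) :
  g p (\sum_i F i) u = \sum_i g p (F i) u.
Proof. by rewrite riemC riem_sumr; apply: eq_bigr => i _; rewrite riemC. Qed.

(** Fewer than five linear equations in five unknowns. *)
Lemma orthogonal_vector m p (s : 'I_m -> 'rV[R]_5) : (m < 5)%N ->
  exists2 v, v != 0 & forall i, g p (s i) v = 0.
Proof.
move=> m5.
have [v v0 vB] := exists_kermx_vector
  (\matrix_(j < 5, i < m) g p (s i) (delta_mx 0 j)) m5.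
exists v => // i; move/rowP: vB => /(_ i).
rewrite !mxE {2}(row_sum_delta v) riem_sumr => vB; rewrite -[RHS]vB.
by apply: eq_bigr => j _; rewrite riemZr mxE.
Qed.

Lemma smooth_inner U X Y : open U -> smooth_vf A U X -> smooth_vf A U Y ->
  smooth_fun A U (inner g X Y).
Proof. by move=> oU sX sY; exact: (riem_smooth hg oU sX sY). Qed.

(** A Gram-Schmidt step for the coordinate field of a vector [v] orthogonal to the given fields at
    [p]. At [p] the correction vanishes, so the new field is nonzero there and can be normalized
    nearby. *)
Lemma orthogonal_unit_field m U (s : 'I_m -> vfield) p : (m < 5)%N ->
  open U -> U p -> (forall i, smooth_vf A U (s i)) ->
  (forall q i j, U q -> inner g (s i) (s j) q = (i == j)%:R) ->
  exists V X, [/\ open V, V `<=` U, V p, smooth_vf A V X &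
    forall q, V q -> inner g X X q = 1 /\ forall i, inner g (s i) X q = 0].
Proof.
move=> m5 oU Up ss so.
have [v v0 sv] := orthogonal_vector p (fun i => s i p) m5.
pose c := chart_at A p; pose F := chart_field c v.
pose U1 := dom c `&` U.
have oU1 : open U1 by apply: openI => //; exact: dom_open.
have U1p : U1 p by split=> //; exact: mem_chart_at.
have sF : smooth_vf A U1 F.
  exact: (smooth_vf_sub (@subIsetl _ _ _) (smooth_chart_field v)).
have ss1 i : smooth_vf A U1 (s i).
  exact: (smooth_vf_sub (@subIsetr _ _ _) (ss i)).
pose Y q := F q + \sum_i (- inner g (s i) F q) *: s i q.
have sY : smooth_vf A U1 Y.
  apply: (smooth_vfD oU1 sF (smooth_vf_sum oU1 _)) => i.
  apply: (smooth_vfZ oU1 (smooth_funN oU1 _) (ss1 i)).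
  exact: (smooth_inner oU1 (ss1 i) sF).
have sYo q i : U1 q -> inner g (s i) Y q = 0.
  move=> [_ Uq]; rewrite /inner /Y riemDr riem_sumr (bigD1 i) //= big1 => [|j ji].
    by rewrite riemZr [g q (s i q) (s i q)]so // eqxx mulr1 addr0 subrr.
  by rewrite riemZr [g q (s i q) (s j q)]so // eq_sym (negbTE ji) mulr0.
have Yp : Y p = v.
  rewrite /Y big1 => [|i _]; first by rewrite addr0 /F chart_field_at.
  by rewrite /inner /F chart_field_at sv oppr0 scale0r.
have Yp0 : 0 < inner g Y Y p by rewrite /inner Yp; exact: (riem_pos hg).
have [V [oV VU1 Vp V0]] := smooth_fun_pos oU1 (smooth_inner oU1 sY sY) U1p Yp0.
have sYV := smooth_vf_sub VU1 sY.
exists V, (fun q => (Num.sqrt (inner g Y Y q))^-1 *: Y q); split; first exact: oV.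
- by move=> q /VU1[].
- exact: Vp.
- exact: (smooth_vfZ oV (smooth_fun_isqrt oV V0 (smooth_inner oV sYV sYV)) sYV).
move=> q Vq; split=> [|i]; last first.
  by rewrite /inner riemZr [g q (s i q) (Y q)]sYo ?mulr0 //; exact: VU1.
rewrite /inner riemZl riemZr mulrA -invfM -expr2 sqr_sqrtr ?mulVf //.
  by rewrite gt_eqF // V0.
by rewrite ltW // V0.
Qed.

End Metric.

Section AdaptedFrame.
Context {R : realType} {M : topologicalType} {A : manifold5 R M}.
Variable S : almost_contact_metric A.
Local Notation vfield := (vfield R M).
Local Notation g := (acm_g S).
Local Notation xi := (acm_xi S).
Local Notation phi := (acm_phi S).
Let hg := acm_riemannian S.

Lemma phi0 p : phi p 0 = 0.
Proof.
have := acm_phi_linear S p (-1) 0 0.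
by rewrite scaler0 addr0 scaleN1r addNr.
Qed.

Lemma phiZ p a u : phi p (a *: u) = a *: phi p u.
Proof. by have := acm_phi_linear S p a u 0; rewrite !addr0 phi0 addr0. Qed.

Lemma phiD p u v : phi p (u + v) = phi p u + phi p v.
Proof. by have := acm_phi_linear S p 1 u v; rewrite !scale1r. Qed.

Lemma phiN p u : phi p (- u) = - phi p u.
Proof. by rewrite -scaleN1r phiZ scaleN1r. Qed.

Lemma phi_sum n p (F : 'I_n -> 'rV[R]_5) :
  phi p (\sum_i F i) = \sum_i phi p (F i).
Proof.
elim: n F => [|n IH] F; first by rewrite !big_ord0 phi0.
by rewrite !big_ord_recl phiD IH.
Qed.

(** The cube of phi, computed as phi applied to phi^2 u and as phi^2 applied to phi u, differs by
    eta(phi u) xi. *)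
Lemma eta_phi p u : g p (xi p) (phi p u) = 0.
Proof.
have := congr1 (phi p) (acm_phi_sq S p u).
rewrite acm_phi_sq phiD phiN phiZ acm_phi_xi scaler0 => /addrI.
move/(congr1 (g p (xi p))).
by rewrite (riem0r hg) (riemZr hg) acm_xi_unit mulr1 acm_eta_dual.
Qed.

Lemma phi_skew p u v : g p (phi p u) v = - g p u (phi p v).
Proof.
have := acm_phi_metric S p u (phi p v).
rewrite acm_phi_sq (riemDr hg) (riemNr hg) (riemZr hg) !acm_eta_dual eta_phi mulr0 subr0.
by rewrite [g p (phi p u) (xi p)](riemC hg) eta_phi mulr0 addr0 => <-; rewrite opprK.
Qed.

Lemma phi_skew_diag p u : g p u (phi p u) = 0.
Proof.
have := phi_skew p u u; rewrite (riemC hg) => /eqP.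
by rewrite -addr_eq0 -mulr2n mulrn_eq0 => /eqP.
Qed.

Lemma exists_adapted_frame U p : open U -> U p ->
  exists V e, [/\ open V, V `<=` U, V p & adapted_frame S V e].
Proof.
move=> oU Up.
have sxi : smooth_vf A U xi by exact: (smooth_vf_sub (@subsetT _ _) (acm_xi_smooth S)).
have xi1 q (i j : 'I_1) : U q -> inner g xi xi q = (i == j)%:R.
  by rewrite (ord1 i) (ord1 j) eqxx => _; exact: acm_xi_unit.
have [V1 [e1 [oV1 V1U V1p se1 e1P]]] :=
  @orthogonal_unit_field _ _ _ _ hg 1 U (fun=> xi) p isT oU Up (fun=> sxi) xi1.
have sxi1 := smooth_vf_sub V1U sxi.
have sphi V X : open V -> smooth_vf A V X ->
    smooth_vf A V (fun q => - phi q (X q)).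
  by move=> oV sX; exact: (smooth_vfN oV (acm_phi_smooth S oV sX)).
(* The sign is forced: Phi(e1, e2) = g(e1, phi e2) = 1 requires phi e2 = e1. *)
pose e2 q := - phi q (e1 q).
have se2 : smooth_vf A V1 e2 by exact: sphi.
have e1e1 q : V1 q -> g q (e1 q) (e1 q) = 1 by case/e1P.
have xie1 q : V1 q -> g q (xi q) (e1 q) = 0 by case/e1P => _ /(_ 0).
have e2e2 q : V1 q -> g q (e2 q) (e2 q) = 1.
  move=> Vq; rewrite /e2 (riemNl hg) (riemNr hg) opprK acm_phi_metric !acm_eta_dual.
  by rewrite xie1 // e1e1 // mulr0 subr0.
have e1e2 q : g q (e1 q) (e2 q) = 0 by rewrite (riemNr hg) phi_skew_diag oppr0.
have xie2 q : g q (xi q) (e2 q) = 0 by rewrite (riemNr hg) eta_phi oppr0.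
(* Including [e2] makes the later [e4] orthogonal to [e1]: g(e1, - phi e3) = g(phi e1, e3) = - g(e2,
   e3). *)
pose s (i : 'I_3) := nth xi [:: xi; e1; e2] i.
have ss i : smooth_vf A V1 (s i).
  case: i => [[|[|[|k]]] lt_k]; [exact: sxi1|exact: se1|exact: se2|].
  discriminate lt_k.
have so q i j : V1 q -> inner g (s i) (s j) q = (i == j)%:R.
  case: i j => [[|[|[|k]]] ?] // [[|[|[|l]]] ?] // Vq; rewrite /inner /s /=;
  rewrite ?acm_xi_unit ?xie1 ?xie2 ?e1e1 ?e2e2 ?e1e2 //;
  by rewrite (riemC hg) ?xie1 ?xie2 ?e1e2.
have [V [e3 [oV VV1 Vp se3 e3P]]] : exists V X, [/\ open V, V `<=` V1, V p,
    smooth_vf A V X & forall q, V q ->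
    inner g X X q = 1 /\ forall i, inner g (s i) X q = 0].
  exact: (@orthogonal_unit_field _ _ _ _ hg 3 V1 s p isT oV1 V1p ss so).
pose e4 q := - phi q (e3 q).
have se4 : smooth_vf A V e4 by exact: sphi.
have e3e3 q : V q -> g q (e3 q) (e3 q) = 1 by case/e3P.
have xie3 q : V q -> g q (xi q) (e3 q) = 0.
  by case/e3P => _ /(_ (@Ordinal 3 0 isT)).
have e1e3 q : V q -> g q (e1 q) (e3 q) = 0.
  by case/e3P => _ /(_ (@Ordinal 3 1 isT)).
have e2e3 q : V q -> g q (e2 q) (e3 q) = 0.
  by case/e3P => _ /(_ (@Ordinal 3 2 isT)).
have e4e4 q : V q -> g q (e4 q) (e4 q) = 1.
  move=> Vq; rewrite /e4 (riemNl hg) (riemNr hg) opprK acm_phi_metric !acm_eta_dual.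
  by rewrite xie3 // e3e3 // mulr0 subr0.
have e3e4 q : g q (e3 q) (e4 q) = 0 by rewrite (riemNr hg) phi_skew_diag oppr0.
have xie4 q : g q (xi q) (e4 q) = 0 by rewrite (riemNr hg) eta_phi oppr0.
have e1e4 q : V q -> g q (e1 q) (e4 q) = 0.
  move=> Vq; rewrite (riemNr hg) -phi_skew -[phi q (e1 q)]opprK (riemNl hg).
  by rewrite e2e3 ?oppr0.
have e2e4 q : V q -> g q (e2 q) (e4 q) = 0.
  move=> Vq; rewrite (riemNl hg) (riemNr hg) opprK acm_phi_metric !acm_eta_dual.
  by rewrite e1e3 // xie3 // mulr0 subr0.
(* The default value of [nth] is the fifth field [xi]. *)
pose e (i : 'I_5) := nth xi [:: e1; e2; e3; e4] i.
have eo q : V q -> forall i j, g q (e i q) (e j q) = (i == j)%:R.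
  move=> Vq; have V1q := VV1 _ Vq.
  elim/I5_ind; elim/I5_ind; rewrite /e /=;
  rewrite ?acm_xi_unit ?e1e1 ?e2e2 ?e3e3 ?e4e4 ?e1e2 ?e1e3 ?e1e4 ?e2e3 ?e2e4
    ?e3e4 ?xie1 ?xie2 ?xie3 ?xie4 //;
  by rewrite (riemC hg) ?e1e2 ?e1e3 ?e1e4 ?e2e3 ?e2e4 ?e3e4 ?xie1 ?xie2 ?xie3 ?xie4.
have se1V := smooth_vf_sub VV1 se1.
have se2V := smooth_vf_sub VV1 se2.
have sxiV := smooth_vf_sub VV1 sxi1.
exists V, e; split; [exact: oV|by move=> q /VV1/V1U|exact: Vp|].
split; first split.
- by elim/I5_ind; [exact: se1V|exact: se2V|exact: se3|exact: se4|exact: sxiV].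
- by move=> q i j Vq; exact: eo.
move=> q Vq; have V1q := VV1 _ Vq; split.
  move=> i j; rewrite /fund /inner /phif.
  have phie : phi q (e j q) = \sum_k Phi0 k j *: e k q.
    rewrite big_I5; move: j; elim/I5_ind; rewrite !mxE /= /e /=;
    rewrite ?(subr0, sub0r, addr0, add0r, oppr0, scale0r, scale1r, scaleN1r) /e2 /e4;
    rewrite ?opprK ?phiN ?acm_phi_sq ?acm_eta_dual ?acm_phi_xi //.
    + by rewrite xie1 // scale0r addr0 opprK.
    + by rewrite xie3 // scale0r addr0 opprK.
  rewrite phie (riem_sumr hg) (bigD1 i) //= big1 => [|k ki].
    by rewrite (riemZr hg) eo // eqxx mulr1 addr0.
  by rewrite (riemZr hg) eo // eq_sym (negbTE ki) mulr0.
by move=> i; rewrite /etaf acm_eta_dual [LHS](eo q Vq i5 i) /eta0 eq_sym.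
Qed.

End AdaptedFrame.

(** * The model space *)

Section ModelAlgebra.
Context {R : realType}.
Implicit Types b : 'M[R]_5.

Definition vandermonde5 (T : pzRingType) (x0 x1 x2 x3 x4 : T) : T :=
  (x1 - x0) * (x2 - x0) * (x3 - x0) * (x4 - x0) *
  ((x2 - x1) * (x3 - x1) * (x4 - x1)) * ((x3 - x2) * (x4 - x2)) * (x4 - x3).

(** For indices below 5 this is the sign of the tuple as a permutation, [None] if an index repeats.
    Over the integers it computes, so claims about all index tuples are settled by evaluation. *)
Definition sgn_vandermonde5 (i j k l m : nat) : option bool :=
  let v := vandermonde5 i%:Z j%:Z k%:Z l%:Z m%:Z in
  if v == 0 then None else Some (0 < v).

Definition levi_civita_symbol (i j k l m : 'I_5) : R :=
  if sgn_vandermonde5 i j k l m is Some s then (if s then 1 else -1) else 0.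

Lemma det_VandermondeI5 (T : comPzRingType) (a : 'rV[T]_5) :
  \det (Vandermonde 5 a) = vandermonde5 (a 0 i1) (a 0 i2) (a 0 i3) (a 0 i4) (a 0 i5).
Proof.
rewrite det_Vandermonde.
under eq_bigr do rewrite big_mkcond.
rewrite !big_ord_recl !big_ord0 /=.
rewrite /vandermonde5 !mulr1 !mul1r !mulrA.
by do ![congr (_ * _)|congr (_ - _)|congr (a 0 _)|exact/val_inj].
Qed.

(** The constant is 1! 2! 3! 4! = 288, the Vandermonde product of 0, 1, 2, 3, 4; permuting these
    numbers changes only its sign. *)
Lemma vandermonde5_table : all (fun i => all (fun j => all (fun k => all (fun l => all
  (fun m => vandermonde5 i%:Z j%:Z k%:Z l%:Z m%:Z ==
     288 * (if sgn_vandermonde5 i j k l m is Some s then (if s then 1 else -1) else 0))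
  (iota 0 5)) (iota 0 5)) (iota 0 5)) (iota 0 5)) (iota 0 5).
Proof. by vm_compute. Qed.

(* The Vandermonde determinant of (i, j, k, l, m) is vol0 i j k l m times that
   of (0, 1, 2, 3, 4), which is 288. *)
Lemma vol0E (i j k l m : 'I_5) : vol0 i j k l m = levi_civita_symbol i j k l m.
Proof.
have h288 : (288 : R) != 0 by rewrite pnatr_eq0.
apply: (mulIf h288).
pose a : 'rV[R]_5 := \row_c (c : nat)%:R.
have E : \det (Vandermonde 5 a) = 288.
  by rewrite det_VandermondeI5 /vandermonde5 !mxE /=; ring.
rewrite /vol0 -[in LHS]E -[X in _ * X]det_tr -det_mulmx.
set B := (_ *m _).
pose s (x : 'I_5) : 'I_5 := nth i [:: i; j; k; l; m] x.
have -> : B = (Vandermonde 5 (\row_x (s x : nat)%:R))^T.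
  apply/matrixP => x y; rewrite !mxE (bigD1 (s x)) //= big1 => [|z zs].
    by rewrite !mxE /= eqxx mul1r addr0.
  by rewrite !mxE /= eq_sym (negbTE zs) mul0r.
rewrite det_tr det_VandermondeI5 !mxE /s /=.
have := vandermonde5_table.
have hi (x : 'I_5) : (x : nat) \in iota 0 5 by rewrite mem_iota ltn_ord.
move=> /allP/(_ _ (hi i))/allP/(_ _ (hi j))/allP/(_ _ (hi k)).
move=> /allP/(_ _ (hi l))/allP/(_ _ (hi m))/eqP.
have vdmR : vandermonde5 (i%:R : R) j%:R k%:R l%:R m%:R =
    (vandermonde5 i%:Z j%:Z k%:Z l%:Z m%:Z)%:~R.
  by rewrite /vandermonde5 !(rmorphM, rmorphB) /=.
rewrite vdmR => ->; rewrite /levi_civita_symbol rmorphM /= mulrC.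
by case: sgn_vandermonde5 => [[]|]; rewrite ?rmorphN ?rmorph1 ?rmorph0.
Qed.

Definition skew5 (a12 a13 a14 a15 a23 a24 a25 a34 a35 a45 : R) : 'M[R]_5 :=
  \matrix_(i, j) nth 0 (nth [::]
   [:: [:: 0; a12; a13; a14; a15];
       [:: - a12; 0; a23; a24; a25];
       [:: - a13; - a23; 0; a34; a35];
       [:: - a14; - a24; - a34; 0; a45];
       [:: - a15; - a25; - a35; - a45; 0]] i) j.

Lemma skewE b i j : b^T = - b -> b i j = - b j i.
Proof. by move/matrixP => /(_ j i); rewrite !mxE. Qed.

Lemma skew_diag b i : b^T = - b -> b i i = 0.
Proof. by move=> /(skewE i i); lra. Qed.

Lemma skew5_skew b : b^T = - b ->
  b = skew5 (b i1 i2) (b i1 i3) (b i1 i4) (b i1 i5) (b i2 i3) (b i2 i4)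
        (b i2 i5) (b i3 i4) (b i3 i5) (b i4 i5).
Proof.
move=> bT; apply/matrixP; elim/I5_ind; elim/I5_ind; rewrite mxE /=;
  by [exact: skew_diag | exact: skewE |].
Qed.

Lemma skew5_ex b : b^T = - b ->
  exists x12 x13 x14 x15 x23 x24 x25 x34 x35 x45,
  b = skew5 x12 x13 x14 x15 x23 x24 x25 x34 x35 x45.
Proof. by move/skew5_skew => E; do 10 eexists; exact: E. Qed.

Lemma skew5T x1 x2 x3 x4 x5 x6 x7 x8 x9 x10 :
  (skew5 x1 x2 x3 x4 x5 x6 x7 x8 x9 x10)^T =
  - skew5 x1 x2 x3 x4 x5 x6 x7 x8 x9 x10.
Proof. by apply/matrixP; elim/I5_ind; elim/I5_ind; rewrite !mxE /= ?opprK ?oppr0. Qed.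

(* the indices i < j complementary to k, l, m and the sign of (i, j, k, l, m) *)
Definition hodge_arg (k l m : nat) : option (nat * nat * bool) :=
  if [seq x <- iota 0 5 | x \notin [:: k; l; m]] is [:: i; j] then
    omap (pair (i, j)) (sgn_vandermonde5 i j k l m)
  else None.

Lemma hodge_arg_table : all (fun k => all (fun l => all (fun m =>
  if hodge_arg k l m is Some (i, j, e) then
    [&& (i < j)%N, (j < 5)%N & all (fun x => all (fun y =>
      sgn_vandermonde5 x y k l m == if (x, y) == (i, j) then Some e
                           else if (x, y) == (j, i) then Some (~~ e) else None)
      (iota 0 5)) (iota 0 5)]
  else all (fun x => all (fun y => sgn_vandermonde5 x y k l m == None)
      (iota 0 5)) (iota 0 5))
  (iota 0 5)) (iota 0 5)) (iota 0 5).
Proof. by vm_compute. Qed.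

Definition ord5 (n : nat) : 'I_5 := nth i1 [:: i1; i2; i3; i4; i5] n.

Lemma ord5K n : (n < 5)%N -> ord5 n = n :> nat.
Proof. by case: n => [|[|[|[|[|n]]]]]. Qed.

(** Only the pair complementary to k, l, m and its transpose contribute; for skew [b] the two terms
    agree, which absorbs the factor 1/2. *)
Lemma star_skew b k l m : b^T = - b ->
  star b k l m = if hodge_arg k l m is Some (i, j, e)
                 then (if e then b (ord5 i) (ord5 j) else - b (ord5 i) (ord5 j))
                 else 0.
Proof.
move=> bT.
have hi (x : 'I_5) : (x : nat) \in iota 0 5 by rewrite mem_iota ltn_ord.
have := hodge_arg_table.
move=> /allP/(_ _ (hi k))/allP/(_ _ (hi l))/allP/(_ _ (hi m)).
have -> : star b k l m =
    2^-1 * \sum_p b p.1 p.2 * levi_civita_symbol p.1 p.2 k l m.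
  by rewrite /star pair_bigA; congr (_ * _); apply: eq_bigr => p _; rewrite vol0E.
case: hodge_arg => [[[i j] e]|] => [/and3P[ij j5]|] /allP tab; last first.
  rewrite big1 ?mulr0 // => -[x y] _ /=.
  have /allP/(_ _ (hi y))/eqP := tab _ (hi x).
  by rewrite /levi_civita_symbol => ->; rewrite mulr0.
have i5' := ltn_trans ij j5.
have lE (x y : 'I_5) : levi_civita_symbol x y k l m =
    if (x, y) == (ord5 i, ord5 j) then (if e then 1 else -1)
    else if (x, y) == (ord5 j, ord5 i) then (if e then -1 else 1) else 0 :> R.
  have /allP/(_ _ (hi y))/eqP := tab _ (hi x).
  rewrite /levi_civita_symbol => ->.
  rewrite !xpair_eqE -!val_eqE /= !ord5K //.
  by case: ifP => //; case: ifP => // _ _; case: e {tab}.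
rewrite (bigD1 (ord5 i, ord5 j)) //= (bigD1 (ord5 j, ord5 i)) /=; last first.
  by rewrite xpair_eqE -!val_eqE /= !ord5K // (gtn_eqF ij).
rewrite big1 => [|[x y] /andP[/negbTE xy /negbTE yx]]; last first.
  by rewrite lE xy yx mulr0.
rewrite !lE !eqxx xpair_eqE -!val_eqE /= !ord5K // (gtn_eqF ij) /=.
rewrite (skewE (ord5 j) (ord5 i) bT).
by case: e {tab lE}; field.
Qed.

Ltac eval_hodge := match goal with |- context[hodge_arg ?a ?b ?c] =>
    let v := eval vm_compute in (hodge_arg a b c) in
    change (hodge_arg a b c) with v end; cbv iota beta.

Definition star5 x12 x13 x14 x15 x23 x24 x25 x34 x35 x45 (k : 'I_5) : 'M[R]_5 := nth 0
  [:: skew5 0 0 0 0 x45 (- x35) x34 x25 (- x24) x23;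
      skew5 0 (- x45) x35 (- x34) 0 0 0 (- x15) x14 (- x13);
      skew5 x45 0 (- x25) x24 0 x15 (- x14) 0 0 x12;
      skew5 (- x35) x25 0 (- x23) (- x15) 0 x13 0 (- x12) 0;
      skew5 x34 (- x24) x23 0 x14 (- x13) 0 x12 0 0] k.

Lemma star_skew5 x12 x13 x14 x15 x23 x24 x25 x34 x35 x45 k i j :
  star (skew5 x12 x13 x14 x15 x23 x24 x25 x34 x35 x45) k i j =
  star5 x12 x13 x14 x15 x23 x24 x25 x34 x35 x45 k i j.
Proof.
move: k i j; elim/I5_ind; elim/I5_ind; elim/I5_ind;
  rewrite star_skew ?skew5T //; eval_hodge; rewrite /star5 !mxE /= ?oppr0 ?opprK //.
Qed.

Lemma eta_wedgeE b k i j : eta_wedge b k i j =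
  (k == i5)%:R * b i j + (i == i5)%:R * b j k + (j == i5)%:R * b k i.
Proof. by []. Qed.

Lemma Phi0E : Phi0 = skew5 1 0 0 0 0 0 0 1 0 0 :> 'M[R]_5.
Proof.
by apply/matrixP; elim/I5_ind; elim/I5_ind; rewrite !mxE /=; ring.
Qed.

(** Integer copies of 2-forms on the complement of e_5, for checking wedge identities by evaluation;
    the absent fifth row is zero by default. *)
Definition int_skew5 (x12 x13 x14 x23 x24 x34 : int) (i j : nat) : int :=
  nth 0 (nth [::]
   [:: [:: 0; x12; x13; x14; 0];
       [:: - x12; 0; x23; x24; 0];
       [:: - x13; - x23; 0; x34; 0];
       [:: - x14; - x24; - x34; 0; 0]] i) j.

Definition int_wedge (a b : nat -> nat -> int) (i j k l : nat) : int :=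
  a i j * b k l - a i k * b j l + a i l * b j k
  + a j k * b i l - a j l * b i k + a k l * b i j.

Lemma int_wedge_table : all (fun i => all (fun j => all (fun k => all (fun l =>
  (int_wedge (int_skew5 1 0 0 0 0 1) (int_skew5 0 1 0 0 (-1) 0) i j k l == 0) &&
  (int_wedge (int_skew5 1 0 0 0 0 1) (int_skew5 0 0 1 1 0 0) i j k l == 0))
  (iota 0 5)) (iota 0 5)) (iota 0 5)) (iota 0 5).
Proof. by vm_compute. Qed.

(** The wedge is linear in its second factor, and the table covers the two generators e13 - e24 and
    e14 + e23. *)
Lemma Phi_wedge_Lambda2_2 s t i j k l :
  Phi_wedge (skew5 0 s t 0 t (- s) 0 0 0 0) i j k l = 0.
Proof.
have hi (x : 'I_5) : (x : nat) \in iota 0 5 by rewrite mem_iota ltn_ord.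
have := int_wedge_table.
move=> /allP/(_ _ (hi i))/allP/(_ _ (hi j))/allP/(_ _ (hi k))/allP/(_ _ (hi l)).
move=> /andP[/eqP E1 /eqP E2].
have PhiE x y : Phi0 x y = (int_skew5 1 0 0 0 0 1 x y)%:~R :> R.
  by rewrite Phi0E; move: x y; elim/I5_ind; elim/I5_ind;
    rewrite !mxE /= ?oppr0.
have bE x y : skew5 0 s t 0 t (- s) 0 0 0 0 x y =
    s * (int_skew5 0 1 0 0 (-1) 0 x y)%:~R + t * (int_skew5 0 0 1 1 0 0 x y)%:~R.
  by move: x y; elim/I5_ind; elim/I5_ind; rewrite !mxE /int_skew5 /=; ring.
transitivity (s * (int_wedge (int_skew5 1 0 0 0 0 1)
   (int_skew5 0 1 0 0 (-1) 0) i j k l)%:~R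
   + t * (int_wedge (int_skew5 1 0 0 0 0 1) (int_skew5 0 0 1 1 0 0) i j k l)%:~R : R).
  rewrite /Phi_wedge /int_wedge !PhiE !bE !(rmorphM, rmorphD, rmorphB) /=; ring.
by rewrite E1 E2 !mulr0 addr0.
Qed.

(** The Hodge condition removes all entries with index 5 and gives b12 = b34, b13 = - b24, b14 =
    b23; the wedge with [Phi0] adds b12 + b34 = 0. What remains is spanned by the real and imaginary
    parts of (e1 + i e2) /\ (e3 + i e4). *)
Lemma Lambda2_2P b : Lambda2_2 b <->
  exists s t, b = skew5 0 s t 0 t (- s) 0 0 0 0.
Proof.
split=> [[bT [Pb sb]]|[s [t ->]]].
  have [x12 [x13 [x14 [x15 [x23 [x24 [x25 [x34 [x35 [x45 bE]]]]]]]]]] := skew5_ex bT.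
  subst b.
  have := (sb i1 i2 i3, sb i1 i2 i4, sb i1 i3 i4, sb i2 i3 i4, sb i1 i2 i5).
  have := (sb i1 i3 i5, sb i1 i4 i5, Pb i1 i2 i3 i4).
  rewrite !star_skew5 !eta_wedgeE /star5 /Phi_wedge !mxE /=.
  rewrite !(mul0r, mul1r, add0r, addr0, subr0, oppr0).
  move=> [[e1 e2] e3] [[[[e4 e5] e6] e7] e8].
  exists x13, x14; congr skew5; lra.
split; first exact: skew5T.
split.
  exact: Phi_wedge_Lambda2_2.
move=> k i j; rewrite star_skew5 eta_wedgeE; move: k i j.
by do 3 elim/I5_ind; rewrite /star5 !mxE /=; ring.
Qed.

Lemma Lambda2_3P b : Lambda2_3 b <->
  exists x y z, b = skew5 x y z 0 (- z) y 0 (- x) 0 0.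
Proof.
split=> [[bT sb]|[x [y [z ->]]]].
  have [x12 [x13 [x14 [x15 [x23 [x24 [x25 [x34 [x35 [x45 bE]]]]]]]]]] := skew5_ex bT.
  subst b.
  have := (sb i1 i2 i3, sb i1 i2 i4, sb i1 i3 i4, sb i2 i3 i4, sb i1 i2 i5).
  have := (sb i1 i3 i5, sb i1 i4 i5).
  rewrite !star_skew5 !eta_wedgeE /star5 !mxE /=.
  rewrite !(mul0r, mul1r, add0r, addr0, subr0, oppr0).
  move=> [e1 e2] [[[[e4 e5] e6] e7] e8].
  exists x12, x13, x14; congr skew5; lra.
split; first exact: skew5T.
move=> k i j; rewrite star_skew5 eta_wedgeE; move: k i j.
by do 3 elim/I5_ind; rewrite /star5 !mxE /=; ring.
Qed.

Lemma Lambda2_4P b : Lambda2_4 b <->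
  exists x y z t, b = skew5 0 0 0 x 0 0 y 0 z t.
Proof.
split=> [[bT sb]|[x [y [z [t ->]]]]].
  exists (b i1 i5), (b i2 i5), (b i3 i5), (b i4 i5).
  rewrite {1}(skew5_skew bT).
  have e i j : i != i5 -> j != i5 -> b i j = 0.
    move=> /negbTE ni /negbTE nj; have := sb i j i5.
    by rewrite eta_wedgeE ni nj eqxx !mul0r !add0r mul1r.
  by rewrite (e i1 i2) // (e i1 i3) // (e i1 i4) // (e i2 i3) // (e i2 i4) // (e i3 i4).
split; first exact: skew5T.
move=> k i j; rewrite eta_wedgeE; move: k i j.
by do 3 elim/I5_ind; rewrite !mxE /=; ring.
Qed.

(** Elements of u(2) satisfy b13 = b24, b14 = - b23 and have no entries with index 5. Hence the
    Lambda^2_2-coordinates are the averages shown, and the decomposition is unique, as [xget]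
    requires. *)
Lemma pr_perp_skew5 x12 x13 x14 x15 x23 x24 x25 x34 x35 x45 :
  pr_perp (skew5 x12 x13 x14 x15 x23 x24 x25 x34 x35 x45) =
  skew5 0 ((x13 - x24) / 2) ((x14 + x23) / 2) x15 ((x14 + x23) / 2)
    (- ((x13 - x24) / 2)) x25 0 x35 x45.
Proof.
apply: xget_unique => [|c [[b2 /Lambda2_2P[s [t ->]]
    [b4 /Lambda2_4P[x [y [z [u ->]]]] <-{c}]]]].
  split.
    exists (skew5 0 ((x13 - x24) / 2) ((x14 + x23) / 2) 0 ((x14 + x23) / 2)
      (- ((x13 - x24) / 2)) 0 0 0 0).
      by apply/Lambda2_2P; do 2 eexists.
    exists (skew5 0 0 0 x15 0 0 x25 0 x35 x45).
      by apply/Lambda2_4P; do 4 eexists.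
    by apply/matrixP; elim/I5_ind; elim/I5_ind; rewrite !mxE /=; ring.
  exists (((x12 + x34) / 2) *: Phi0); first by eexists.
  exists (skew5 ((x12 - x34) / 2) ((x13 + x24) / 2) ((x14 - x23) / 2) 0
    (- ((x14 - x23) / 2)) ((x13 + x24) / 2) 0 (- ((x12 - x34) / 2)) 0 0).
    by apply/Lambda2_3P; do 3 eexists.
  rewrite Phi0E.
  by apply/matrixP; elim/I5_ind; elim/I5_ind; rewrite !mxE /=; field.
move=> [_ [r ->] [b3 /Lambda2_3P[a [b [c ->]]]]].
rewrite Phi0E => /matrixP E.
have := (E i1 i3, E i1 i4, E i2 i3, E i2 i4).
have := (E i1 i5, E i2 i5, E i3 i5, E i4 i5).
rewrite !mxE /= => -[[[e1 e2] e3] e4] [[[e5 e6] e7] e8].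
by apply/matrixP; elim/I5_ind; elim/I5_ind; rewrite !mxE /=; lra.
Qed.

(* The intrinsic torsion of a generalized quasi-Sasaki manifold: y is
   (X, Y) |-> g(nabla_X xi, Y) and (s, t) are the coordinates of Gamma(xi) in
   Lambda^2_2 with respect to e13 - e24 and e14 + e23. *)
Definition gqs_torsion (y12 y13 y14 y23 y24 y34 s t : R) : L1L2 :=
  [ffun k : 'I_5 => nth 0
  [:: skew5 0 0 0 0 0 0 (- y12) 0 (- y13) (- y14);
      skew5 0 0 0 y12 0 0 0 0 (- y23) (- y24);
      skew5 0 0 0 y13 0 0 y23 0 0 (- y34);
      skew5 0 0 0 y14 0 0 y24 0 y34 0;
      skew5 0 s t 0 t (- s) 0 0 0 0] k].

Lemma theta_skew5 x12 x13 x14 x15 x23 x24 x25 x34 x35 x45 :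
  theta (skew5 x12 x13 x14 x15 x23 x24 x25 x34 x35 x45) =
  [ffun k => star5 x12 x13 x14 x15 x23 x24 x25 x34 x35 x45 k].
Proof.
apply/ffunP => k; rewrite !ffunE; apply/matrixP => i j.
by rewrite mxE star_skew5.
Qed.

Ltac L1L2_eq := apply/ffunP; elim/I5_ind; rewrite !ffunE /= ?pr_perp_skew5;
  apply/matrixP; elim/I5_ind; elim/I5_ind; rewrite !mxE /=.

(** Here *Phi = eta /\ Phi, whose value in the direction xi is Phi itself; it lies in u(2) and is
    projected away. *)
Lemma W3P a : W3 a <->
  exists x, a = gqs_torsion (- x) 0 0 0 0 (- x) 0 0.
Proof.
have E x : pr_W (theta (x *: Phi0)) = gqs_torsion (- x) 0 0 0 0 (- x) 0 0.
  have -> : x *: Phi0 = skew5 x 0 0 0 0 0 0 x 0 0.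
    rewrite Phi0E; apply/matrixP; elim/I5_ind; elim/I5_ind; rewrite !mxE /=; ring.
  by rewrite theta_skew5; L1L2_eq; field.
split=> [[_ [_ [x ->] <-] <-]|[x ->]]; first by exists x.
rewrite -E; do 2 (apply: imageP); by exists x.
Qed.

(** On Lambda^2_2 one has theta(beta) = eta /\ beta: the direction xi gives beta, the others give b
    = - beta. *)
Lemma W4P a : W4 a <->
  exists s t, a = gqs_torsion 0 (- s) (- t) (- t) s 0 s t.
Proof.
have E s t : theta (skew5 0 s t 0 t (- s) 0 0 0 0) =
    gqs_torsion 0 (- s) (- t) (- t) s 0 s t.
  by rewrite theta_skew5; L1L2_eq; ring.
split=> [[_ /Lambda2_2P[s [t ->]] <-]|[s [t ->]]]; first by exists s, t.
by rewrite -E; apply: imageP; apply/Lambda2_2P; exists s, t.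
Qed.

(** Now theta(beta) = - eta /\ beta: the direction xi gives - beta, projected away as an element of
    u(2), and b = beta remains. *)
Lemma W5P a : W5 a <->
  exists x y z, a = gqs_torsion x y z (- z) y (- x) 0 0.
Proof.
have E x y z : pr_W (theta (skew5 x y z 0 (- z) y 0 (- x) 0 0)) =
    gqs_torsion x y z (- z) y (- x) 0 0.
  by rewrite theta_skew5; L1L2_eq; field.
split=> [[_ [_ /Lambda2_3P[x [y [z ->]]] <-] <-]|[x [y [z ->]]]].
  by exists x, y, z.
by rewrite -E; do 2 (apply: imageP); apply/Lambda2_3P; exists x, y, z.
Qed.

(** Since vartheta(beta) = 3 eta (x) beta - eta /\ beta, the direction xi gives 2 beta and the
    others give b = beta. *)
Lemma W7P a : W7 a <->
  exists s t, a = gqs_torsion 0 s t t (- s) 0 (2 * s) (2 * t).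
Proof.
have E s t : vartheta (skew5 0 s t 0 t (- s) 0 0 0 0) =
    gqs_torsion 0 s t t (- s) 0 (2 * s) (2 * t).
  have -> : vartheta (skew5 0 s t 0 t (- s) 0 0 0 0) =
      [ffun k => \matrix_(i, j) (3 * (eta0 k * skew5 0 s t 0 t (- s) 0 0 0 0 i j)
        - star5 0 s t 0 t (- s) 0 0 0 0 k i j)].
    apply/ffunP => k; rewrite !ffunE; apply/matrixP => i j.
    by rewrite !mxE star_skew5.
  by L1L2_eq; rewrite /eta0 /star5 /= ?mxE /=; ring.
split=> [[_ /Lambda2_2P[s [t ->]] <-]|[s [t ->]]]; first by exists s, t.
by rewrite -E; apply: imageP; apply/Lambda2_2P; exists s, t.
Qed.

(** [W3] and [W5] realize every Lambda^2_1- and Lambda^2_3-part of y and vanish in the direction xi;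
    only the Lambda^2_2-part of y is tied to (s, t), through [W4]. *)
Lemma gqs_torsion_W345 y12 y13 y14 y23 y24 y34 s t :
  sum_set (sum_set W3 W4) W5 (gqs_torsion y12 y13 y14 y23 y24 y34 s t) <->
  2 * s = y24 - y13 /\ 2 * t = - (y14 + y23).
Proof.
split=> [[_ [_ /W3P[x ->] [_ /W4P[u [v ->]] <-]] [_ /W5P[a [b [c ->]]]]]|[es et]].
  move=> /ffunP E; have := congr1 (fun B : 'M[R]_5 => (B i3 i5, B i4 i5)) (E i1).
  have := congr1 (fun B : 'M[R]_5 => (B i3 i5, B i4 i5)) (E i2).
  have := congr1 (fun B : 'M[R]_5 => (B i1 i3, B i1 i4)) (E i5).
  rewrite !ffunE /= !mxE /= => -[e1 e2] [e3 e4] [e5 e6]; lra.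
(* The double minus keeps the shape of [W3P], used with x = - (y12 + y34) / 2. *)
exists (gqs_torsion (- (- ((y12 + y34) / 2))) 0 0 0 0 (- (- ((y12 + y34) / 2))) 0 0
  + gqs_torsion 0 (- s) (- t) (- t) s 0 s t).
  exists (gqs_torsion (- (- ((y12 + y34) / 2))) 0 0 0 0 (- (- ((y12 + y34) / 2))) 0 0).
    by apply/W3P; eexists.
  by eexists; [apply/W4P; exists s, t; reflexivity|].
exists (gqs_torsion ((y12 - y34) / 2) ((y13 + y24) / 2) ((y14 - y23) / 2)
  (- ((y14 - y23) / 2)) ((y13 + y24) / 2) (- ((y12 - y34) / 2)) 0 0).
  by apply/W5P; do 3 eexists.
by L1L2_eq; lra.
Qed.

Lemma gqs_torsion_W7 y12 y13 y14 y23 y24 y34 s t :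
  W7 (gqs_torsion y12 y13 y14 y23 y24 y34 s t) <->
  [/\ y12 = 0, y34 = 0, y13 + y24 = 0 & y14 - y23 = 0] /\
  (s = 2 * y13 /\ t = 2 * y14).
Proof.
split=> [/W7P[u [v /ffunP E]]|[[-> -> e1 e2] [-> ->]]].
  have := congr1 (fun B : 'M[R]_5 => (B i2 i5, B i3 i5, B i4 i5)) (E i1).
  have := congr1 (fun B : 'M[R]_5 => (B i3 i5, B i4 i5)) (E i2).
  have := congr1 (fun B : 'M[R]_5 => B i4 i5) (E i3).
  have := congr1 (fun B : 'M[R]_5 => (B i1 i3, B i1 i4)) (E i5).
  rewrite !ffunE /= !mxE /= => -[e1 e2] e7 [e3 e4] [e5 e6 e8].
  by split; [split|split]; lra.
by apply/W7P; exists y13, y14; L1L2_eq; lra.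
Qed.

End ModelAlgebra.

(** * Tensoriality *)

Section Orthonormal.
Context {R : realType} {M : topologicalType} {A : manifold5 R M}.
Variable g : M -> 'rV[R]_5 -> 'rV[R]_5 -> R.
Hypothesis hg : riemannian A g.
Variable p : M.
Implicit Types (e f : 'I_5 -> 'rV[R]_5) (u v : 'rV[R]_5).

Definition linear_form (h : 'rV[R]_5 -> R) :=
  forall a u v, h (a *: u + v) = a * h u + h v.

Lemma linear_form_sum h n (a : 'I_n -> R) (F : 'I_n -> 'rV[R]_5) : linear_form h ->
  h (\sum_i a i *: F i) = \sum_i a i * h (F i).
Proof.
move=> hl; elim: n a F => [|n IH] a F.
  have := hl (-1) 0 0; rewrite !big_ord0 scaler0 addr0; lra.
by rewrite !big_ord_recl hl IH.
Qed.

Definition orthonormal_at e := forall i j, g p (e i) (e j) = (i == j)%:R.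

(** Orthonormality says E B = 1; for square matrices B E = 1 follows, and this is the expansion. *)
Lemma orthonormal_expand e u : orthonormal_at e ->
  u = \sum_i g p u (e i) *: e i.
Proof.
move=> oe.
pose E : 'M[R]_5 := \matrix_(i, j) e i 0 j.
pose B : 'M[R]_5 := \matrix_(j, i) g p (delta_mx 0 j) (e i).
have uB v : v *m B = \row_i g p v (e i).
  apply/rowP => i; rewrite !mxE [in RHS](row_sum_delta v) (riem_suml hg).
  by apply: eq_bigr => j _; rewrite (riemZl hg) mxE.
have rE i : row i E = e i by apply/rowP => j; rewrite !mxE.
have EB : E *m B = 1%:M.
  apply/row_matrixP => i; rewrite row_mul rE uB.
  by apply/rowP => j; rewrite !mxE oe.
rewrite -[LHS]mulmx1 -(mulmx1C EB) mulmxA uB mulmx_sum_row.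
by apply: eq_bigr => i _; rewrite mxE rE.
Qed.

Lemma trilinear_eq0 e (T : 'rV[R]_5 -> 'rV[R]_5 -> 'rV[R]_5 -> R) :
  orthonormal_at e ->
  (forall v w, linear_form (fun u => T u v w)) ->
  (forall u w, linear_form (fun v => T u v w)) ->
  (forall u v, linear_form (T u v)) ->
  (forall i j k, T (e i) (e j) (e k) = 0) -> forall u v w, T u v w = 0.
Proof.
move=> oe l1 l2 l3 T0 u v w.
rewrite (orthonormal_expand u oe) (linear_form_sum _ _ (l1 v w)).
apply: big1 => i _; rewrite (orthonormal_expand v oe) (linear_form_sum _ _ (l2 _ w)).
rewrite big1 ?mulr0 // => j _.
rewrite (orthonormal_expand w oe) (linear_form_sum _ _ (l3 _ _)).
by rewrite big1 ?mulr0 // => k _; rewrite T0 mulr0.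
Qed.

(** The transition matrix [Q] is orthogonal. This matters because tracelessness is tested on
    arbitrary orthonormal frames, while the torsion is known in adapted ones. *)
Lemma trace_orthonormal e f (B : 'rV[R]_5 -> 'rV[R]_5 -> R) :
  orthonormal_at e -> orthonormal_at f ->
  (forall v, linear_form (B^~ v)) -> (forall u, linear_form (B u)) ->
  \sum_i B (f i) (f i) = \sum_i B (e i) (e i).
Proof.
move=> oe of_ l1 l2.
pose Q : 'M[R]_5 := \matrix_(i, a) g p (f i) (e a).
have QQ : Q *m Q^T = 1%:M.
  apply/matrixP => i j; rewrite !mxE -of_ {1}(orthonormal_expand (f i) oe).
  rewrite (riem_suml hg); apply: eq_bigr => a _.
  by rewrite !mxE (riemZl hg) (riemC hg _ (e a)).
have /mulmx1C QtQ := QQ.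
transitivity (\sum_a \sum_b (Q^T *m Q) a b * B (e a) (e b)); last first.
  rewrite QtQ; apply: eq_bigr => a _; rewrite (bigD1 a) //= big1 => [|b ba].
    by rewrite mxE eqxx mul1r addr0.
  by rewrite mxE eq_sym (negbTE ba) mul0r.
transitivity (\sum_i \sum_a \sum_b Q i a * Q i b * B (e a) (e b)).
  apply: eq_bigr => i _.
  rewrite {1}(orthonormal_expand (f i) oe) (linear_form_sum _ _ (l1 _)).
  apply: eq_bigr => a _.
  rewrite (orthonormal_expand (f i) oe) (linear_form_sum _ _ (l2 _)) big_distrr /=.
  apply: eq_bigr => b _; rewrite -(orthonormal_expand (f i) oe) !mxE.
  by rewrite mulrA.
rewrite exchange_big; apply: eq_bigr => a _; rewrite exchange_big.
apply: eq_bigr => b _; rewrite mxE big_distrl /=.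
by apply: eq_bigr => i _; rewrite !mxE.
Qed.

End Orthonormal.

(** * The exterior derivatives and N through nabla phi and nabla xi *)

Section Tensor.
Context {R : realType} {M : topologicalType} {A : manifold5 R M}.
Variables (S : almost_contact_metric A).
Local Notation vfield := (vfield R M).
Variable D : vfield -> vfield -> vfield.
Hypothesis hLC : levi_civita A (acm_g S) D.
Local Notation g := (acm_g S).
Local Notation xi := (acm_xi S).
Local Notation phi := (acm_phi S).
Let hg := acm_riemannian S.
Let hD : connection A D := hLC.1.1.

Definition nabla_phi (X Y : vfield) (q : M) : 'rV[R]_5 :=
  D X (phif S Y) q - phi q (D X Y q).

Variables (U : set M) (p : M).
Hypotheses (oU : open U) (Up : U p).
Local Notation smooth X := (smooth_vf A U X).

Lemma smooth_xi : smooth xi.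
Proof. exact: (smooth_vf_sub (@subsetT _ _) (acm_xi_smooth S)). Qed.

Lemma smooth_phif X : smooth X -> smooth (phif S X).
Proof. by move=> sX; exact: (acm_phi_smooth S oU sX). Qed.

Lemma metricE X Y Z : smooth X -> smooth Y -> smooth Z ->
  dirder A X (inner g Y Z) p = inner g (D X Y) Z p + inner g Y (D X Z) p.
Proof. by move=> sX sY sZ; exact: (hLC.1.2 U). Qed.

Lemma lieE X Y : smooth X -> smooth Y -> lie A X Y p = D X Y p - D Y X p.
Proof. by move=> sX sY; exact: (esym (hLC.2 U X Y p oU sX sY Up)). Qed.

Lemma detaE Y Z : smooth Y -> smooth Z ->
  deta S D Y Z p = g p (D Y xi p) (Z p) - g p (D Z xi p) (Y p).
Proof.
move=> sY sZ; rewrite /deta /ext_d1 /nabla1.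
have E X : etaf S X = inner g xi X by apply/funext => q; exact: acm_eta_dual.
have sx := smooth_xi.
rewrite !E (metricE sY sx sZ) (metricE sZ sx sY) /inner; ring.
Qed.

Lemma dfundE X Y Z : smooth X -> smooth Y -> smooth Z ->
  dfund S D X Y Z p = g p (Y p) (nabla_phi X Z p) + g p (Z p) (nabla_phi Y X p)
    + g p (X p) (nabla_phi Z Y p).
Proof.
move=> sX sY sZ.
have E X' Y' Z' : smooth X' -> smooth Y' -> smooth Z' ->
    nabla2 A D (fund S) X' Y' Z' p = g p (Y' p) (nabla_phi X' Z' p).
  move=> sX' sY' sZ'; rewrite /nabla2 /fund.
  rewrite (metricE sX' sY' (smooth_phif sZ')) /inner /nabla_phi /phif.
  by rewrite (riemDr hg) (riemNr hg); ring.
by rewrite /dfund /ext_d2 !E.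
Qed.

(** Torsion-freeness turns brackets into covariant derivatives. With D_X (phi Y) = (nabla_X phi) Y +
    phi (D_X Y), all terms free of nabla phi cancel. *)
Lemma nijenhuisE X Y Z : smooth Y -> smooth Z ->
  nijenhuis S D X Y Z p =
  g p (X p) (nabla_phi (phif S Y) Z p - nabla_phi (phif S Z) Y p
    - phi p (nabla_phi Y Z p) + phi p (nabla_phi Z Y p))
  + g p (xi p) (X p) * (g p (D Y xi p) (Z p) - g p (D Z xi p) (Y p)).
Proof.
move=> sY sZ; rewrite /nijenhuis detaE // /etaf acm_eta_dual /inner.
congr (g p _ _ + _); rewrite /phi_bracket {2 3}/phif.
have [pY pZ] := (smooth_phif sY, smooth_phif sZ).
rewrite (lieE pY pZ) /phif (lieE sY sZ) (lieE pY sZ) (lieE sY pZ) /nabla_phi.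
by rewrite !(phiD, phiN); apply/rowP => j; rewrite !mxE; ring.
Qed.

Lemma killingE X Y : killing A g xi -> smooth X -> smooth Y ->
  g p (D X xi p) (Y p) + g p (D Y xi p) (X p) = 0.
Proof.
move=> hK sX sY; have sx := smooth_xi.
have := hK U X Y p oU sX sY Up.
rewrite (metricE sx sX sY) /inner (lieE sx sX) (lieE sx sY).
rewrite !(riemDl hg, riemDr hg, riemNl hg, riemNr hg) => E.
rewrite (riemC hg _ (D Y xi p)); lra.
Qed.

End Tensor.

(** * Torsion in an adapted frame *)

Section TorsionForm.
Context {R : realType} {T : Type}.
Variables (F : T -> T -> T -> R) (b : T -> T -> R) (eta : T -> R).
Variables (phi : T -> T) (c : T -> R) (xi : T).

(* phi v is understood as c v times phi v, so that the formulas cover both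
   tangent vectors (with c = 1) and the indices of an adapted frame. *)
Definition nijenhuis_form x y z : R :=
  c y * F (phi y) z x - c z * F (phi z) y x
  + c x * (F y z (phi x) - F z y (phi x)) + eta x * (b y z - b z y).

Definition dfund_form x y z : R := F x z y + F y x z + F z y x.

Definition deta_gamma_form x y : R :=
  b x y - b y x - c x * dfund_form xi (phi x) y.

(** The difference g(nabla^c_x y - nabla_x y, z); as nabla is torsion-free, its antisymmetrization
    in x, y is the torsion of nabla^c. *)
Definition contorsion_form x y z : R :=
  2^-1 * (deta_gamma_form x y * eta z + deta_gamma_form y z * eta x
          + deta_gamma_form z x * eta y - nijenhuis_form x y z).

Definition torsion_form x y z : R :=
  contorsion_form x y z - contorsion_form y x z.

End TorsionForm.

Section FrameAlgebra.
Context {R : realType}.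
Implicit Types w : 'I_5 -> 'M[R]_5.

(* phi e_i = phi_sgn i e_(phi_ind i) *)
Definition phi_ind (i : 'I_5) : 'I_5 := nth i5 [:: i2; i1; i4; i3; i5] i.
Definition phi_sgn (i : 'I_5) : R := nth 0 [:: -1; 1; -1; 1; 0] i.

(** With w k i j = g(nabla_{e_k} e_i, e_j), this is F(e_k; e_i, e_j); the second term has a plus
    sign because phi is skew. *)
Definition nabla_phi_comp w (k i j : 'I_5) : R :=
  phi_sgn i * w k (phi_ind i) j + phi_sgn j * w k i (phi_ind j).

Definition nijenhuis_comp w := nijenhuis_form (nabla_phi_comp w)
  (fun k j => w k i5 j) eta0 phi_ind phi_sgn.
Definition dfund_comp w := dfund_form (nabla_phi_comp w).
Definition torsion_comp w := torsion_form (nabla_phi_comp w)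
  (fun k j => w k i5 j) eta0 phi_ind phi_sgn i5.

(** The conclusion is that [w k] has no Lambda^2_2-part. The four components of dPhi and the four of
    N chosen below determine these eight unknowns. *)
Lemma horizontal_integrability w : (forall k, (w k)^T = - w k) ->
  (forall i j k, i != i5 -> j != i5 -> k != i5 ->
    nijenhuis_comp w i j k = 0 /\ dfund_comp w i j k = 0) ->
  forall k, k != i5 -> w k i1 i3 = w k i2 i4 /\ w k i1 i4 = - w k i2 i3.
Proof.
move=> wT H.
have [_ d1] := H i1 i2 i3 isT isT isT; have [_ d2] := H i1 i2 i4 isT isT isT.
have [_ d3] := H i1 i3 i4 isT isT isT; have [_ d4] := H i2 i3 i4 isT isT isT.
have [n1 _] := H i1 i1 i3 isT isT isT; have [n2 _] := H i1 i1 i4 isT isT isT.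
have [n3 _] := H i3 i1 i3 isT isT isT; have [n4 _] := H i3 i1 i4 isT isT isT.
move: d1 d2 d3 d4 n1 n2 n3 n4.
rewrite /nijenhuis_comp /dfund_comp /dfund_form /nijenhuis_form /nabla_phi_comp.
rewrite /phi_sgn /phi_ind /eta0 /= !(mul1r, mul0r, mulN1r, addr0).
have E k := (skew_diag i1 (wT k), skew_diag i2 (wT k), skew_diag i3 (wT k),
  skew_diag i4 (wT k), skewE i2 i1 (wT k), skewE i3 i1 (wT k),
  skewE i4 i1 (wT k), skewE i3 i2 (wT k), skewE i4 i2 (wT k), skewE i4 i3 (wT k)).
rewrite !E => d1 d2 d3 d4 n1 n2 n3 n4.
by elim/I5_ind => // _; split; lra.
Qed.

(** For X orthogonal to xi only F(X; Y, xi) = - b(X, phi Y) survives, up to skewness; in the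
    direction xi only the Lambda^2_2-part of the connection form does, doubled. *)
Definition gqs_nabla_phi (y12 y13 y14 y23 y24 y34 s t : R) (k : 'I_5) : 'M[R]_5 :=
  nth 0 [:: skew5 0 0 0 y12 0 0 0 0 y14 (- y13);
            skew5 0 0 0 0 0 0 y12 0 y24 (- y23);
            skew5 0 0 0 (- y23) 0 0 y13 0 y34 0;
            skew5 0 0 0 (- y24) 0 0 y14 0 0 y34;
            skew5 0 (- (2 * t)) (2 * s) 0 (2 * s) (2 * t) 0 0 0 0] k.

Lemma gqs_connection w : (forall k, (w k)^T = - w k) ->
  (forall i j, w i i5 j + w j i5 i = 0) ->
  (forall i j k, i != i5 -> j != i5 -> k != i5 ->
    nijenhuis_comp w i j k = 0 /\ dfund_comp w i j k = 0) ->
  exists y12 y13 y14 y23 y24 y34 s t,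
    [/\ [ffun k => pr_perp (w k)] = gqs_torsion y12 y13 y14 y23 y24 y34 s t,
        forall i j, w i i5 j = skew5 y12 y13 y14 0 y23 y24 0 y34 0 0 i j &
        forall k i j, nabla_phi_comp w k i j =
          gqs_nabla_phi y12 y13 y14 y23 y24 y34 s t k i j].
Proof.
move=> wT wK wH.
exists (w i1 i5 i2), (w i1 i5 i3), (w i1 i5 i4), (w i2 i5 i3), (w i2 i5 i4),
  (w i3 i5 i4), ((w i5 i1 i3 - w i5 i2 i4) / 2), ((w i5 i1 i4 + w i5 i2 i3) / 2).
have wh := horizontal_integrability wT wH.
have [h1 h1'] := wh i1 isT; have [h2 h2'] := wh i2 isT.
have [h3 h3'] := wh i3 isT; have [h4 h4'] := wh i4 isT.
have D k i := skew_diag i (wT k).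
have E5 k i := skewE i i5 (wT k).
have E k := (E5 k i1, E5 k i2, E5 k i3, E5 k i4, skewE i2 i1 (wT k),
  skewE i3 i1 (wT k), skewE i4 i1 (wT k), skewE i3 i2 (wT k),
  skewE i4 i2 (wT k), skewE i4 i3 (wT k)).
have K i j : w i i5 j = - w j i5 i by have := wK i j; lra.
have Kd i : w i i5 i = 0 by have := wK i i; lra.
(* A unit Killing field is geodesic, so b has no component along xi. *)
have K55 i : w i5 i5 i = 0 by rewrite K D oppr0.
have KK := (K i2 i1, K i3 i1, K i4 i1, K i3 i2, K i4 i2, K i4 i3).
split.
- apply/ffunP => k; rewrite !ffunE (skew5_skew (wT k)) pr_perp_skew5 !E.
  move: k; elim/I5_ind; rewrite /= ?h1 ?h1' ?h2 ?h2' ?h3 ?h3' ?h4 ?h4';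
  rewrite ?(subrr, addNr, mul0r, oppr0) ?Kd ?KK ?K55 ?opprK ?oppr0 //.
- elim/I5_ind; elim/I5_ind; rewrite !mxE /= ?Kd ?KK ?K55 ?D ?oppr0 //.
- move=> k i j; rewrite /nabla_phi_comp /phi_sgn /phi_ind /gqs_nabla_phi.
  move: k; elim/I5_ind; move: i j; elim/I5_ind; elim/I5_ind; rewrite !mxE /=;
  rewrite ?D ?E ?h1 ?h1' ?h2 ?h2' ?h3 ?h3' ?h4 ?h4' ?Kd ?KK ?K55;
  first [by ring | by field].
Qed.

Section Components.
Variables (w : 'I_5 -> 'M[R]_5) (y12 y13 y14 y23 y24 y34 s t : R).
Hypothesis bE : forall i j, w i i5 j = skew5 y12 y13 y14 0 y23 y24 0 y34 0 0 i j.
Hypothesis FE : forall k i j, nabla_phi_comp w k i j =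
  gqs_nabla_phi y12 y13 y14 y23 y24 y34 s t k i j.

Let s' := (y13 - y24) / 2.
Let t' := (y14 + y23) / 2.
Let Y : 'M[R]_5 := skew5 y12 y13 y14 0 y23 y24 0 y34 0 0.
(* the Lambda^2_2 parts of Y and of Gamma(xi) - Y *)
Let P : 'M[R]_5 := skew5 0 s' t' 0 t' (- s') 0 0 0 0.
Let Q : 'M[R]_5 := skew5 0 (s - s') (t - t') 0 (t - t') (s' - s) 0 0 0 0.

(** As b is skew, d eta = 2b; and gamma = 2Q. *)
Lemma deta_gamma_compE i j :
  deta_gamma_form (nabla_phi_comp w) (fun k j => w k i5 j) phi_ind phi_sgn i5 i j =
  2 * (Y i j - Q i j).
Proof.
rewrite /deta_gamma_form /dfund_form !FE !bE.
rewrite /gqs_nabla_phi /phi_sgn /phi_ind /Y /Q /s' /t'.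
by move: i j; elim/I5_ind; elim/I5_ind; rewrite !mxE /=; field.
Qed.

Lemma nijenhuis_compE i j k : nijenhuis_comp w i j k =
  4 * (eta0 i * P j k) + 2 * (eta0 j * Q i k) - 2 * (eta0 k * Q i j).
Proof.
rewrite /nijenhuis_comp /nijenhuis_form !FE !bE.
(* Eliminating y13 and y14 and then generalizing s', t' leaves polynomial identities without
   division. *)
have [e13 e14] : y13 = y24 + 2 * s' /\ y14 = 2 * t' - y23.
  by rewrite /s' /t'; split; field.
rewrite /gqs_nabla_phi /phi_sgn /phi_ind /eta0 /P /Q e13 e14.
move: s' t' => u v.
by move: i j k; do 3 elim/I5_ind; rewrite !mxE /=; ring.
Qed.

Let YT i j : Y j i = - Y i j. Proof. exact: skewE (skew5T _ _ _ _ _ _ _ _ _ _). Qed.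
Let PT i j : P j i = - P i j. Proof. exact: skewE (skew5T _ _ _ _ _ _ _ _ _ _). Qed.
Let QT i j : Q j i = - Q i j. Proof. exact: skewE (skew5T _ _ _ _ _ _ _ _ _ _). Qed.

Lemma torsion_compE i j k : torsion_comp w i j k =
  2 * (Y i j * eta0 k) + eta0 i * (2 * Y j k - Q j k - 2 * P j k)
  - eta0 j * (2 * Y i k - Q i k - 2 * P i k).
Proof.
rewrite /torsion_comp /torsion_form /contorsion_form.
rewrite -!/(nijenhuis_comp w _ _ _) !deta_gamma_compE !nijenhuis_compE.
by rewrite (YT i j) (YT i k) (YT j k) (QT i j) (QT i k) (QT j k); field.
Qed.

Lemma skew_torsion_comp :
  (forall i j k, torsion_comp w i j k + torsion_comp w i k j = 0) <->
  2 * s = y24 - y13 /\ 2 * t = - (y14 + y23).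
Proof.
split=> [H|[es et]].
  have := (H i1 i3 i5, H i1 i4 i5).
  rewrite !torsion_compE /Y /P /Q !mxE /eta0 /= /s' /t'.
  by move=> [e1 e2]; lra.
(* This is d = - P, written with Q = d - P. *)
have QP i j : Q i j = - 2 * P i j.
  rewrite /Q /P /s' /t'.
  by move: i j; elim/I5_ind; elim/I5_ind; rewrite !mxE /=; lra.
by move=> i j k; rewrite !torsion_compE !QP (YT j k) (PT j k); ring.
Qed.

Lemma cyclic_torsion_comp :
  (forall i j k, torsion_comp w i j k + torsion_comp w j k i
    + torsion_comp w k i j = 0) <->
  [/\ y12 = 0, y34 = 0, y13 + y24 = 0 & y14 - y23 = 0] /\
  (s = 2 * y13 /\ t = 2 * y14).
Proof.
split=> [H|[[e12 e34 e24 e23] [es et]]].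
  have := (H i1 i2 i5, H i3 i4 i5, H i1 i3 i5, H i2 i4 i5, H i1 i4 i5, H i2 i3 i5).
  rewrite !torsion_compE /Y /P /Q !mxE /eta0 /= /s' /t'.
  move=> [[[[[h1 h2] h3] h4] h5] h6].
  by split; [split|split]; lra.
(* This is 3b = P + d, written with Q = d - P. *)
have QP i j : Q i j = 3 * Y i j - 2 * P i j.
  rewrite /Q /P /Y /s' /t'.
  by move: i j; elim/I5_ind; elim/I5_ind; rewrite !mxE /=; lra.
move=> i j k; rewrite !torsion_compE !QP.
by rewrite (YT i k) (YT i j) (YT j k) (PT i k) (PT i j) (PT j k); ring.
Qed.

(** Each summand vanishes, because [Y], [P] and [Q] are skew and have no entries with index 5. *)
Lemma trace_torsion_comp i : \sum_a torsion_comp w i a a = 0.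
Proof.
rewrite big_I5 !torsion_compE /eta0 /Y /P /Q; move: s' t' => u v.
by move: i; elim/I5_ind; rewrite !mxE /=; ring.
Qed.

End Components.
End FrameAlgebra.

(** * From frames to tensors *)

Section TorsionFormLinear.
Context {R : realType}.
Local Notation V := 'rV[R]_5.
Variables (F : V -> V -> V -> R) (b : V -> V -> R) (eta : V -> R) (phi : V -> V).
Variable xi : V.
Hypotheses (F1 : forall y z, linear_form (fun x => F x y z))
  (F2 : forall x z, linear_form (fun y => F x y z)) (F3 : forall x y, linear_form (F x y))
  (b1 : forall y, linear_form (b^~ y)) (b2 : forall x, linear_form (b x))
  (etal : linear_form eta)
  (phil : forall a u v, phi (a *: u + v) = a *: phi u + phi v).
Local Notation T := (torsion_form F b eta phi (fun=> 1) xi).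

Let F1' y z a u v : F (a *: u + v) y z = a * F u y z + F v y z.
Proof. exact: F1. Qed.
Let F2' x z a u v : F x (a *: u + v) z = a * F x u z + F x v z.
Proof. exact: (F2 x z). Qed.
Let F3' x y a u v : F x y (a *: u + v) = a * F x y u + F x y v.
Proof. exact: F3. Qed.
Let b1' y a u v : b (a *: u + v) y = a * b u y + b v y.
Proof. exact: b1. Qed.
Let b2' x a u v : b x (a *: u + v) = a * b x u + b x v.
Proof. exact: b2. Qed.

Ltac expand_form := rewrite /torsion_form /contorsion_form /deta_gamma_form
  /nijenhuis_form /dfund_form !(phil, F1', F2', F3', b1', b2', etal); ring.

Lemma torsion_form_lin1 y z : linear_form (fun x => T x y z).
Proof. by move=> a u v; expand_form. Qed.

Lemma torsion_form_lin2 x z : linear_form (fun y => T x y z).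
Proof. by move=> a u v; expand_form. Qed.

Lemma torsion_form_lin3 x y : linear_form (T x y).
Proof. by move=> a u v; expand_form. Qed.

End TorsionFormLinear.

Section AdaptedFrameTorsion.
Context {R : realType} {M : topologicalType} {A : manifold5 R M}.
Variables (S : almost_contact_metric A).
Local Notation vfield := (vfield R M).
Variable D : vfield -> vfield -> vfield.
Hypothesis hLC : levi_civita A (acm_g S) D.
Local Notation g := (acm_g S).
Local Notation xi := (acm_xi S).
Local Notation phi := (acm_phi S).
Let hg := acm_riemannian S.
Let hD : connection A D := hLC.1.1.
Variables (U : set M) (p : M).
Hypotheses (oU : open U) (Up : U p).
Local Notation smooth X := (smooth_vf A U X).
Variable e : 'I_5 -> vfield.
Hypothesis he : adapted_frame S U e.
Implicit Types X Y Z : vfield.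

Let se i : smooth (e i) := he.1.1 i.
Let oe q : U q -> orthonormal_at g q (e^~ q).
Proof. by move=> Uq i j; exact: he.1.2. Qed.

Lemma adapted_xi q : U q -> xi q = e i5 q.
Proof.
move=> Uq; rewrite (orthonormal_expand hg (xi q) (oe Uq)) (bigD1 i5) //=.
have E i : g q (xi q) (e i q) = eta0 i.
  by rewrite -acm_eta_dual; exact: (he.2 q Uq).2.
rewrite E /eta0 eqxx scale1r big1 ?addr0 // => i /negbTE ni.
by rewrite E /eta0 ni scale0r.
Qed.

Lemma adapted_phi q i : U q ->
  phi q (e i q) = phi_sgn i *: e (phi_ind i) q.
Proof.
move=> Uq; rewrite [LHS](orthonormal_expand hg _ (oe Uq)).
have E j : g q (phi q (e i q)) (e j q) = Phi0 j i.
  by rewrite (riemC hg); exact: (he.2 q Uq).1.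
under eq_bigr do rewrite E Phi0E mxE.
rewrite big_I5 /phi_sgn /phi_ind; move: i {E}; elim/I5_ind => /=;
by rewrite ?oppr0 ?scale0r ?addr0 ?add0r.
Qed.

(** nabla phi at [p] as a bilinear map on tangent vectors, extended from the frame; [nabla_phiE]
    shows that it computes the value on fields, which is tensoriality. *)
Definition frame_nabla_phi (x y : 'rV[R]_5) : 'rV[R]_5 :=
  \sum_i g p y (e i p) *:
    \sum_k g p x (e k p) *: nabla_phi S D (e k) (e i) p.

Definition frame_nabla_xi (x : 'rV[R]_5) : 'rV[R]_5 :=
  \sum_k g p x (e k p) *: D (e k) xi p.

Lemma smooth_comp X i : smooth X -> smooth_fun A U (inner g X (e i)).
Proof. by move=> sX; exact: (smooth_inner hg oU sX (se i)). Qed.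

Lemma frame_expand X q : U q -> X q = \sum_i inner g X (e i) q *: e i q.
Proof. by move=> Uq; exact: (orthonormal_expand hg _ (oe Uq)). Qed.

Lemma conn_frame X Y : smooth X -> smooth Y ->
  D X Y p = \sum_k g p (X p) (e k p) *: D (e k) Y p.
Proof.
move=> sX sY.
rewrite (conn_local_l hD oU sX sY Up (@frame_expand X)).
exact: (conn_suml hD oU (fun i => smooth_comp i sX) se sY Up).
Qed.

Lemma nabla_xiE X : smooth X -> D X xi p = frame_nabla_xi (X p).
Proof. by move=> sX; exact: (conn_frame sX (@smooth_xi _ _ _ S U)). Qed.

Lemma nabla_phiE X Y : smooth X -> smooth Y ->
  nabla_phi S D X Y p = frame_nabla_phi (X p) (Y p).
Proof.
move=> sX sY; have sf i := smooth_comp i sY.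
have sphi i : smooth (phif S (e i)) by exact: (smooth_phif S oU (se i)).
have phiE q : U q -> phif S Y q = \sum_i inner g Y (e i) q *: phif S (e i) q.
  move=> Uq; rewrite {1}/phif (frame_expand Y Uq) phi_sum.
  by apply: eq_bigr => i _; rewrite phiZ.
rewrite /nabla_phi.
rewrite (conn_local_r hD oU sX (smooth_phif S oU sY) Up phiE).
rewrite (conn_local_r hD oU sX sY Up (@frame_expand Y)).
rewrite (conn_sumr hD oU sX sf sphi Up) (conn_sumr hD oU sX sf se Up).
rewrite phi_sum -sumrB; apply: eq_bigr => i _.
(* The derivatives of the coefficients of [Y] occur in both sums and cancel. *)
rewrite phiD !phiZ opprD addrACA subrr add0r -scalerBr; congr (_ *: _).
rewrite (conn_frame sX (sphi i)) (conn_frame sX (se i)) phi_sum -sumrB.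
by apply: eq_bigr => k _; rewrite phiZ -scalerBr.
Qed.

Let F (x y z : 'rV[R]_5) : R := g p (frame_nabla_phi x y) z.
Let b (x y : 'rV[R]_5) : R := g p (frame_nabla_xi x) y.
Local Notation eta := (g p (xi p)).

Lemma nijenhuis_vecE X Y Z : smooth X -> smooth Y -> smooth Z ->
  nijenhuis S D X Y Z p =
  nijenhuis_form F b eta (phi p) (fun=> 1) (X p) (Y p) (Z p).
Proof.
move=> sX sY sZ; rewrite (nijenhuisE hLC oU Up X sY sZ) /nijenhuis_form.
have [pY pZ] := (smooth_phif S oU sY, smooth_phif S oU sZ).
rewrite !nabla_phiE // !nabla_xiE //.
have Xphi v : g p (X p) (phi p v) = - g p v (phi p (X p)).
  by rewrite (riemC hg) phi_skew.
have Xsym x y : g p (X p) (frame_nabla_phi x y) = F x y (X p) by rewrite (riemC hg).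
by rewrite !(riemDr hg, riemNr hg) !Xphi !Xsym /F /b /phif; ring.
Qed.

Lemma dfund_vecE X Y Z : smooth X -> smooth Y -> smooth Z ->
  dfund S D X Y Z p = dfund_form F (X p) (Y p) (Z p).
Proof.
move=> sX sY sZ; rewrite (dfundE hLC oU Up sX sY sZ) /dfund_form /F.
by rewrite !nabla_phiE // !(riemC hg _ (frame_nabla_phi _ _)).
Qed.

Lemma deta_gamma_vecE X Y : smooth X -> smooth Y ->
  deta S D X Y p - gammaf S D X Y p =
  deta_gamma_form F b (phi p) (fun=> 1) (xi p) (X p) (Y p).
Proof.
move=> sX sY; have sx := @smooth_xi _ _ _ S U.
rewrite (detaE hLC oU Up sX sY) /gammaf.
rewrite (dfund_vecE sx (smooth_phif S oU sX) sY) !nabla_xiE //.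
by rewrite /deta_gamma_form mul1r.
Qed.

Lemma torsion_vecE Dc X Y Z : characteristic_formula S D Dc ->
  smooth X -> smooth Y -> smooth Z ->
  torsion A g Dc X Y Z p =
  torsion_form F b eta (phi p) (fun=> 1) (xi p) (X p) (Y p) (Z p).
Proof.
move=> hDc sX sY sZ; rewrite /torsion /inner (lieE hLC oU Up sX sY).
rewrite !(riemDl hg, riemNl hg).
have E X' Y' : smooth X' -> smooth Y' -> g p (Dc X' Y' p) (Z p) =
    g p (D X' Y' p) (Z p) +
    contorsion_form F b eta (phi p) (fun=> 1) (xi p) (X' p) (Y' p) (Z p).
  move=> sX' sY'; have := hDc U X' Y' Z p oU sX' sY' sZ Up.
  rewrite /inner => ->; congr (_ + _); rewrite /contorsion_form /wedge_eta.
  rewrite !deta_gamma_vecE // nijenhuis_vecE // /etaf !acm_eta_dual.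
  by [].
rewrite (E X Y) // (E Y X) // /torsion_form; ring.
Qed.

Let F_lin1 y z : linear_form (fun x => F x y z).
Proof.
move=> a u v; rewrite /F /frame_nabla_phi !(riem_suml hg) big_distrr -big_split /=.
apply: eq_bigr => i _; rewrite !(riemZl hg) !(riem_suml hg) !big_distrr -big_split /=.
by apply: eq_bigr => k _; rewrite !(riemZl hg, riemDl hg); ring.
Qed.

Let F_lin2 x z : linear_form (fun y => F x y z).
Proof.
move=> a u v; rewrite /F /frame_nabla_phi !(riem_suml hg) big_distrr -big_split /=.
by apply: eq_bigr => i _; rewrite !(riemZl hg, riemDl hg); ring.
Qed.

Let F_lin3 x y : linear_form (F x y).
Proof. by move=> a u v; rewrite /F (riemDr hg) (riemZr hg). Qed.

Let b_lin1 y : linear_form (b^~ y).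
Proof.
move=> a u v; rewrite /b /frame_nabla_xi !(riem_suml hg) big_distrr -big_split /=.
by apply: eq_bigr => i _; rewrite !(riemZl hg, riemDl hg); ring.
Qed.

Let b_lin2 x : linear_form (b x).
Proof. by move=> a u v; rewrite /b (riemDr hg) (riemZr hg). Qed.

Let eta_lin : linear_form eta.
Proof. by move=> a u v; rewrite (riemDr hg) (riemZr hg). Qed.

Definition connection_comp (k : 'I_5) : 'M[R]_5 :=
  \matrix_(i, j) inner g (D (e k) (e i)) (e j) p.
Local Notation w := connection_comp.

Lemma connection_comp_skew k : (w k)^T = - w k.
Proof.
apply/matrixP => i j; rewrite !mxE.
have := metricE hLC oU Up (se k) (se j) (se i).
rewrite (dirder_cst A _ oU Up (fun q Uq => he.1.2 q j i Uq)) /inner.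
rewrite [g p (e j p) _](riemC hg) => E; lra.
Qed.

Let nabla_xi_frame k : D (e k) xi p = D (e k) (e i5) p.
Proof.
exact: (conn_local_r hD oU (se k) (@smooth_xi _ _ _ S U) Up adapted_xi).
Qed.

Let sum_frame (T : lmodType R) (G : 'I_5 -> T) k :
  \sum_i g p (e k p) (e i p) *: G i = G k.
Proof.
rewrite (bigD1 k) //= (oe Up) eqxx scale1r big1 ?addr0 // => i ik.
by rewrite (oe Up) eq_sym (negbTE ik) scale0r.
Qed.

Lemma F_frame k i j : F (e k p) (e i p) (e j p) = nabla_phi_comp w k i j.
Proof.
rewrite /F /frame_nabla_phi !sum_frame /nabla_phi.
have phiE q : U q -> phif S (e i) q = phi_sgn i *: e (phi_ind i) q.
  exact: adapted_phi.
rewrite (conn_local_r hD oU (se k) (smooth_phif S oU (se i)) Up phiE).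
rewrite (conn_leibniz hD oU (@smooth_fun_cst _ _ A U _) (se k) (se _) Up).
rewrite (dirder_cst A _ oU Up (fun _ _ => erefl)) scale0r add0r.
rewrite (riemDl hg) (riemNl hg) (riemZl hg) phi_skew opprK (adapted_phi _ Up) (riemZr hg).
by rewrite /nabla_phi_comp !mxE.
Qed.

Lemma b_frame k j : b (e k p) (e j p) = w k i5 j.
Proof. by rewrite /b /frame_nabla_xi sum_frame nabla_xi_frame mxE. Qed.

Let phi_frame i : phi p (e i p) = phi_sgn i *: e (phi_ind i) p.
Proof. exact: adapted_phi. Qed.

Let eta_frame i : eta (e i p) = eta0 i.
Proof. by rewrite -acm_eta_dual; exact: (he.2 p Up).2. Qed.

Let FZ1 a x y z : F (a *: x) y z = a * F x y z.
Proof.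
have := F_lin1 y z a x 0; have := F_lin1 y z (-1) 0 0.
rewrite scaler0 !addr0 => E0 ->; lra.
Qed.
Let FZ2 a x y z : F x (a *: y) z = a * F x y z.
Proof.
have := F_lin2 x z a y 0; have := F_lin2 x z (-1) 0 0.
rewrite scaler0 !addr0 => E0 ->; lra.
Qed.
Let FZ3 a x y z : F x y (a *: z) = a * F x y z.
Proof. by rewrite /F (riemZr hg). Qed.

Ltac eval_frame := rewrite ?eta_frame ?(adapted_xi Up) !phi_frame
  !(FZ1, FZ2, FZ3) ?F_frame ?b_frame /=; ring.

Lemma nijenhuis_form_frame i j k :
  nijenhuis_form F b eta (phi p) (fun=> 1) (e i p) (e j p) (e k p) =
  nijenhuis_comp w i j k.
Proof. by rewrite /nijenhuis_comp /nijenhuis_form; eval_frame. Qed.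

Lemma dfund_form_frame i j k :
  dfund_form F (e i p) (e j p) (e k p) = dfund_comp w i j k.
Proof. by rewrite /dfund_comp /dfund_form !F_frame. Qed.

Lemma deta_gamma_form_frame i j :
  deta_gamma_form F b (phi p) (fun=> 1) (xi p) (e i p) (e j p) =
  deta_gamma_form (nabla_phi_comp w) (fun k j => w k i5 j) phi_ind phi_sgn i5 i j.
Proof. by rewrite /deta_gamma_form /dfund_form; eval_frame. Qed.

Lemma torsion_form_frame i j k :
  torsion_form F b eta (phi p) (fun=> 1) (xi p) (e i p) (e j p) (e k p) =
  torsion_comp w i j k.
Proof.
rewrite /torsion_comp /torsion_form /contorsion_form.
by rewrite !deta_gamma_form_frame !nijenhuis_form_frame !eta_frame.
Qed.

(** Everything needed at one point: the torsion is a trilinear form there, and its conditions on the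
    frame are the same equations in y, s, t that characterize the classes. *)
Lemma gqs_frame_torsion Dc : generalized_quasi_sasaki S D ->
  characteristic_formula S D Dc ->
  exists (T : 'rV[R]_5 -> 'rV[R]_5 -> 'rV[R]_5 -> R) y12 y13 y14 y23 y24 y34 s t,
  [/\ intrinsic_torsion S D e p = gqs_torsion y12 y13 y14 y23 y24 y34 s t,
      [/\ forall y z, linear_form (fun x => T x y z),
          forall x z, linear_form (fun y => T x y z) &
          forall x y, linear_form (T x y)],
      forall X Y Z, smooth X -> smooth Y -> smooth Z ->
        torsion A g Dc X Y Z p = T (X p) (Y p) (Z p) &
      [/\ (forall i j k, T (e i p) (e j p) (e k p) + T (e i p) (e k p) (e j p) = 0)
            <-> 2 * s = y24 - y13 /\ 2 * t = - (y14 + y23),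
          (forall i j k, T (e i p) (e j p) (e k p) + T (e j p) (e k p) (e i p)
             + T (e k p) (e i p) (e j p) = 0) <->
          [/\ y12 = 0, y34 = 0, y13 + y24 = 0 & y14 - y23 = 0] /\
          (s = 2 * y13 /\ t = 2 * y14) &
          forall i, \sum_a T (e i p) (e a p) (e a p) = 0]].
Proof.
move=> [hI hK] hDc.
have wK i j : w i i5 j + w j i5 i = 0.
  have := killingE hLC oU Up hK (se i) (se j).
  by rewrite !nabla_xi_frame !mxE.
have wH i j k : i != i5 -> j != i5 -> k != i5 ->
    nijenhuis_comp w i j k = 0 /\ dfund_comp w i j k = 0.
  move=> ni nj nk; rewrite -nijenhuis_form_frame -dfund_form_frame.
  rewrite -(nijenhuis_vecE (se i) (se j) (se k)) -(dfund_vecE (se i) (se j) (se k)).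
  (* The definition tests fields orthogonal to [xi] on all of [U]; the first four frame fields
     qualify, since [xi] is the fifth throughout [U]. *)
  apply: (hI U _ _ _ p oU (se i) (se j) (se k)) => // q Uq.
  by rewrite /inner (adapted_xi Uq) !(oe Uq) (negbTE ni) (negbTE nj) (negbTE nk).
have [y12 [y13 [y14 [y23 [y24 [y34 [s [t [EG Eb EF]]]]]]]]] :=
  gqs_connection connection_comp_skew wK wH.
exists (torsion_form F b eta (phi p) (fun=> 1) (xi p)).
exists y12, y13, y14, y23, y24, y34, s, t.
have phil a u v : phi p (a *: u + v) = a *: phi p u + phi p v.
  exact: acm_phi_linear.
split; first exact: EG.
- split=> x y.
  + exact: torsion_form_lin1.
  + exact: torsion_form_lin2.
  + exact: torsion_form_lin3.
- by move=> X Y Z sX sY sZ; exact: torsion_vecE.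
split.
- rewrite -(skew_torsion_comp Eb EF).
  by split=> H i j k; have := H i j k; rewrite !torsion_form_frame.
- rewrite -(cyclic_torsion_comp Eb EF).
  by split=> H i j k; have := H i j k; rewrite !torsion_form_frame.
move=> i; rewrite -[RHS](trace_torsion_comp Eb EF i).
by apply: eq_bigr => a _; rewrite torsion_form_frame.
Qed.

End AdaptedFrameTorsion.

Theorem proposition3p2 (R : realType) (M : topologicalType)
    (A : manifold5 R M) (S : almost_contact_metric A)
    (Dg Dc : vfield R M -> vfield R M -> vfield R M)
    (hLC : levi_civita A (acm_g S) Dg)
    (hS : generalized_quasi_sasaki S Dg)
    (hmetric : metric_connection A (acm_g S) Dc)
    (hDc : characteristic_formula S Dg Dc) :
  (totally_skew_torsion A (acm_g S) Dc <->
   of_class S Dg (sum_set (sum_set W3 W4) W5)) /\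
  (traceless_cyclic_torsion A (acm_g S) Dc <-> of_class S Dg W7).
Proof.
have hg := acm_riemannian S.
have smoothI U V X : V `<=` U -> smooth_vf A U X -> smooth_vf A V X.
  exact: smooth_vf_sub.
split; split.
- move=> hT U e p oU he Up.
  have [T [y12 [y13 [y14 [y23 [y24 [y34 [s [t [-> _ TE [H _ _]]]]]]]]]]] :=
    gqs_frame_torsion hLC oU Up he hS hDc.
  apply/gqs_torsion_W345/H => i j k; have se := he.1.1.
  rewrite -(TE _ _ _ (se i) (se j) (se k)) -(TE _ _ _ (se i) (se k) (se j)).
  exact: (hT U _ _ _ p oU (se i) (se j) (se k) Up).
- move=> hW U X Y Z p oU sX sY sZ Up.
  (* The class hypothesis speaks only about adapted frames, so one is constructed on a smaller
     neighbourhood, to which the fields are restricted. *)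
  have [V [e [oV VU Vp he]]] := exists_adapted_frame S oU Up.
  have [T [y12 [y13 [y14 [y23 [y24 [y34 [s [t [GE [T1 T2 T3] TE [H _ _]]]]]]]]]]] :=
    gqs_frame_torsion hLC oV Vp he hS hDc.
  have [sX' sY' sZ'] := And3 (smoothI _ _ _ VU sX) (smoothI _ _ _ VU sY)
    (smoothI _ _ _ VU sZ).
  rewrite (TE _ _ _ sX' sY' sZ') (TE _ _ _ sX' sZ' sY').
  have := hW V e p oV he Vp; rewrite GE => /gqs_torsion_W345/H H0.
  apply: (trilinear_eq0 hg (e := e^~ p)
    (T := fun x y z => T x y z + T x z y)) => //.
  + by move=> i j; exact: he.1.2.
  + by move=> y z a u v; rewrite T1 T1; ring.
  + by move=> x z a u v; rewrite T2 T3; ring.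
  + by move=> x y a u v; rewrite T2 T3; ring.
- move=> [hT _] U e p oU he Up.
  have [T [y12 [y13 [y14 [y23 [y24 [y34 [s [t [-> _ TE [_ H _]]]]]]]]]]] :=
    gqs_frame_torsion hLC oU Up he hS hDc.
  apply/gqs_torsion_W7/H => i j k; have se := he.1.1.
  rewrite -(TE _ _ _ (se i) (se j) (se k)) -(TE _ _ _ (se j) (se k) (se i)).
  rewrite -(TE _ _ _ (se k) (se i) (se j)).
  exact: (hT U _ _ _ p oU (se i) (se j) (se k) Up).
move=> hW; split.
  move=> U X Y Z p oU sX sY sZ Up.
  have [V [e [oV VU Vp he]]] := exists_adapted_frame S oU Up.
  have [T [y12 [y13 [y14 [y23 [y24 [y34 [s [t [GE [T1 T2 T3] TE [_ H _]]]]]]]]]]] :=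
    gqs_frame_torsion hLC oV Vp he hS hDc.
  have [sX' sY' sZ'] := And3 (smoothI _ _ _ VU sX) (smoothI _ _ _ VU sY)
    (smoothI _ _ _ VU sZ).
  rewrite (TE _ _ _ sX' sY' sZ') (TE _ _ _ sY' sZ' sX') (TE _ _ _ sZ' sX' sY').
  have := hW V e p oV he Vp; rewrite GE => /gqs_torsion_W7/H H0.
  apply: (trilinear_eq0 hg (e := e^~ p)
    (T := fun x y z => T x y z + T y z x + T z x y)) => //.
  + by move=> i j; exact: he.1.2.
  + by move=> y z a u v; rewrite T1 T2 T3; ring.
  + by move=> x z a u v; rewrite T1 T2 T3; ring.
  + by move=> x y a u v; rewrite T1 T2 T3; ring.
move=> U X f p oU sX [sf of_] Up.
have [V [e [oV VU Vp he]]] := exists_adapted_frame S oU Up.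
have [T [y12 [y13 [y14 [y23 [y24 [y34 [s [t [GE [T1 T2 T3] TE [_ _ H]]]]]]]]]]] :=
  gqs_frame_torsion hLC oV Vp he hS hDc.
(* The frame [f] is merely orthonormal, so its trace is first moved to the adapted frame [e]. *)
have oe : orthonormal_at (acm_g S) p (e^~ p) by move=> i j; exact: he.1.2.
have of' : orthonormal_at (acm_g S) p (f^~ p) by move=> i j; exact: of_.
under eq_bigr => i _ do rewrite (TE _ _ _ (smoothI _ _ _ VU sX)
  (smoothI _ _ _ VU (sf i)) (smoothI _ _ _ VU (sf i))).
rewrite (trace_orthonormal hg oe of' (T2 (X p)) (T3 (X p))).
rewrite (orthonormal_expand hg (X p) oe).
under eq_bigr => a _ do rewrite (linear_form_sum _ _ (T1 _ _)).
rewrite exchange_big big1 // => i _ /=.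
by rewrite -big_distrr /= H mulr0.
Qed.
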